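(* Let $n\ge 0$ be an integer, let $X$ be a paracompact space, let $Y$ be a paracompact $C$-space, and let $f\colon X\to Y$ be a $\sigma$-perfect surjection with $\dim f\leq n$. Let $$\mathcal{H}=\{g\in C(X,\mathbb{I}^{n+1}) : \dim g(f^{-1}(y))\leq n \text{ for each } y\in Y\}.$$ Then $\mathcal{H}$ is a dense $G_\delta$-subset of $C(X,\mathbb{I}^{n+1})$ with respect to the source limitation topology.
   Context: $\mathbb{I}=[0,1]$; $\dim$ is covering dimension; single-valued maps are continuous; paracompact spaces are Hausdorff. $C(X,Z)$ is the set of all continuous maps from $X$ to $Z$. The cube $\mathbb{I}^{n+1}$ carries the Euclidean metric. $\dim f=\sup\{\dim f^{-1}(y): y\in Y\}$. A map is perfect if it is continuous, closed, and has compact fibers. A map $f\colon X\to Y$ is $\sigma$-perfect if there is a sequence $\{X_i\}$ of closed subsets of $X$ with $X=\bigcup_i X_i$ such that each restriction $f|X_i\colon X_i\to f(X_i)$ is perfect and each $f(X_i)$ is closed in $Y$. $Y$ is a $C$-space (has property $C$) if for every sequence $\{\omega_k\}_{k\ge1}$ of open covers of $Y$ there is a sequence $\{\gamma_k\}_{k\ge 1}$ such that each $\gamma_k$ is a family of pairwise disjoint open subsets of $Y$, every member of $\gamma_k$ is contained in some member of $\omega_k$, and $\bigcup_k\gamma_k$ covers $Y$. Source limitation topology on $C(X,Z)$, $(Z,d)$ a metric space: $U\subset C(X,Z)$ is open if for every $g\in U$ there is a continuous $\alpha\colon X\to(0,\infty)$ with $\overline{B}(g,\alpha)\subset U$, where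 $\overline{B}(g,\alpha)=\{h\in C(X,Z): d(g(x),h(x))\leq\alpha(x)\text{ for each }x\in X\}$. *)

(* Defs.v *)
From HB Require Import structures.
From mathcomp Require Import all_boot all_order all_algebra.
From mathcomp Require Import all_classical all_reals all_analysis.
From mathcomp Require Import ring.
Set Implicit Arguments.
Unset Strict Implicit.
Unset Printing Implicit Defensive.
Import Order.TTheory GRing.Theory Num.Theory.
Import numFieldNormedType.Exports.

Local Open Scope classical_set_scope.
Local Open Scope card_scope.
Local Open Scope ring_scope.

Section covers.
Context {T : topologicalType}.
Implicit Types U V : set (set T).

Definition open_cover U := U `<=` open /\ \bigcup_(A in U) A = setT.

Definition refines V U := forall B, V B -> exists2 A, U A & B `<=` A.

Definition locally_finite V :=
  forall x : T, exists2 N, nbhs x N & finite_set [set B | V B /\ B `&` N !=set0].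

(* Every point lies in at most [k] members of [V]. *)
Definition multiplicity_le V (k : nat) :=
  forall x : T, [set B | V B /\ B x] #<= `I_k.

End covers.

Definition paracompact (T : topologicalType) : Prop :=
  hausdorff_space T /\
  forall U : set (set T), open_cover U ->
    exists V, [/\ open_cover V, refines V U & locally_finite V].

Definition C_space (T : topologicalType) : Prop :=
  forall omega : nat -> set (set T), (forall k, open_cover (omega k)) ->
    exists gamma : nat -> set (set T),
      [/\ forall k, gamma k `<=` open,
          forall k, trivIset (gamma k) id,
          forall k, refines (gamma k) (omega k) &
          \bigcup_k \bigcup_(A in gamma k) A = setT].

(* [covdim_lt T k] means [dim T <= k - 1]; for [k = 0] it says that [T] is
   empty, in accordance with the convention [dim set0 = -1]. *)
Definition covdim_lt (T : topologicalType) (k : nat) : Prop :=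
  forall U : set (set T), finite_set U -> open_cover U ->
    exists V, [/\ finite_set V, open_cover V, refines V U &
                  multiplicity_le V k].

Definition covdim (R : realType) (T : topologicalType) : \bar R :=
  ereal_inf [set (k%:R - 1)%:E | k in covdim_lt T].

(* A set [A] used as a type is [set_type A] with the subspace topology. *)
Definition dim_map (R : realType) (X Y : topologicalType) (f : X -> Y) :
    \bar R :=
  ereal_sup (range (fun y : Y => covdim R (f @^-1` [set y]))).

Definition perfect_map (X Y : topologicalType) (f : X -> Y) : Prop :=
  [/\ continuous f,
      forall A : set X, closed A -> closed (f @` A) &
      forall y : Y, compact (f @^-1` [set y])].

(* [sigLR [fun f in A]] is the restriction of [f] seen as a map from the
   subspace [A] onto the subspace [f @` A]. *)
Definition sigma_perfect_map (X Y : topologicalType) (f : X -> Y) : Prop :=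
  continuous f /\
  exists F : nat -> set X,
    [/\ forall i, closed (F i),
        \bigcup_i F i = setT,
        forall i, perfect_map (sigLR [fun f in F i]) &
        forall i, closed (f @` F i)].

(* [continuousType X Z] with the source limitation topology. *)
Definition source_lim (R : realType) (X : topologicalType) (Z : metricType R) :
  Type := continuousType X Z.

Section source_limitation.
Context {R : realType} {X : topologicalType} {Z : metricType R}.

HB.instance Definition _ := Choice.on (source_lim X Z).

Definition source_cball (g : source_lim X Z) (alpha : X -> R) :
    set (source_lim X Z) :=
  [set h : source_lim X Z | forall x, mdist (g x) (h x) <= alpha x].

Definition source_open (U : set (source_lim X Z)) : Prop :=
  forall g, U g -> exists alpha : X -> R,
    [/\ continuous alpha, forall x, 0 < alpha x & source_cball g alpha `<=` U].

Let source_openT : source_open setT.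
Proof. by move=> g _; exists (cst 1); split => //; exact: cst_continuous. Qed.

Let source_openI : setI_closed source_open.
Proof.
move=> U V oU oV g [/oU[a [ca a0 aU]] /oV[b [cb b0 bV]]].
exists (fun x => Num.min (a x) (b x)); split.
- by move=> x; apply: continuous_min; [exact: ca|exact: cb].
- by move=> x; rewrite lt_min a0 b0.
- by move=> h gh; split; [apply: aU|apply: bV] => x;
    have := gh x; rewrite le_min => /andP[].
Qed.

Let source_open_bigU (I : Type) (F : I -> set (source_lim X Z)) :
  (forall i, source_open (F i)) -> source_open (\bigcup_i F i).
Proof.
move=> oF g [i _ /oF[a [ca a0 aF]]]; exists a; split => //.
by move=> h /aF Fh; exists i.
Qed.

HB.instance Definition _ := isOpenTopological.Build (source_lim X Z)
  source_openT source_openI source_open_bigU.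

End source_limitation.

Definition cube (R : realType) (n : nat) : Type :=
  {x : 'rV[R]_n | [forall i, 0 <= x ord0 i <= 1]}.

Section cube_metric.
Context {R : realType} {n : nat}.

HB.instance Definition _ := [Choice of cube R n by <:].

Definition eucl_dist (x y : 'rV[R]_n) : R :=
  Num.sqrt (\sum_i (x ord0 i - y ord0 i) ^+ 2).

Let cube_dist (x y : cube R n) : R := eucl_dist (val x) (val y).

Let cube_distxx x : cube_dist x x = 0.
Proof.
by rewrite /cube_dist /eucl_dist big1 ?sqrtr0// => i _; rewrite subrr expr0n.
Qed.

Let cube_dist_eq0 x y : cube_dist x y = 0 -> x = y.
Proof.
move=> /eqP; rewrite sqrtr_eq0 => s0.
apply/val_inj/rowP => i; apply/eqP; rewrite -subr_eq0 -sqrf_eq0 eq_le sqr_ge0.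
rewrite andbT (le_trans _ s0)// (bigD1 i)//= lerDl.
by apply: sumr_ge0 => j _; exact: sqr_ge0.
Qed.

Let cube_distC x y : cube_dist x y = cube_dist y x.
Proof.
by congr Num.sqrt; apply: eq_bigr => i _; rewrite -sqrrN opprB.
Qed.

Let CauchySchwarz (a b : 'I_n -> R) :
  (\sum_i a i * b i) ^+ 2 <= (\sum_i a i ^+ 2) * (\sum_i b i ^+ 2).
Proof.
set A := \sum_i a i ^+ 2; set B := \sum_i b i ^+ 2; set P := \sum_i a i * b i.
have B0 : 0 <= B by apply: sumr_ge0 => i _; exact: sqr_ge0.
have key (t s : R) : 0 <= t ^+ 2 * A - 2 * (t * s) * P + s ^+ 2 * B.
  have -> : t ^+ 2 * A - 2 * (t * s) * P + s ^+ 2 * B =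
            \sum_i (t * a i - s * b i) ^+ 2.
    rewrite /A /P /B !mulr_sumr -sumrN -!big_split/=.
    by apply: eq_bigr => i _; ring.
  by apply: sumr_ge0 => i _; exact: sqr_ge0.
move: B0; rewrite le_eqVlt => /predU1P[B0|B0].
  have b0 i : b i = 0.
    apply/eqP; rewrite -sqrf_eq0 eq_le sqr_ge0 andbT B0 /B (bigD1 i)//= lerDl.
    by apply: sumr_ge0 => j _; exact: sqr_ge0.
  by rewrite -B0 /P big1 ?expr0n ?mulr0// => i _; rewrite b0 mulr0.
have := key B P.
rewrite [leRHS](_ : _ = B * (A * B - P ^+ 2)); last by ring.
by rewrite pmulr_rge0// subr_ge0.
Qed.

Let cube_dist_triangle y x z :
  cube_dist x z <= cube_dist x y + cube_dist y z.
Proof.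
rewrite /cube_dist /eucl_dist.
set A := \sum_i (val x ord0 i - val y ord0 i) ^+ 2.
set B := \sum_i (val y ord0 i - val z ord0 i) ^+ 2.
pose P := \sum_i (val x ord0 i - val y ord0 i) * (val y ord0 i - val z ord0 i).
have A0 : 0 <= A by apply: sumr_ge0 => i _; exact: sqr_ge0.
have B0 : 0 <= B by apply: sumr_ge0 => i _; exact: sqr_ge0.
have -> : \sum_i (val x ord0 i - val z ord0 i) ^+ 2 = A + P *+ 2 + B.
  rewrite /A /P /B -sumrMnl -!big_split/=.
  by apply: eq_bigr => i _; rewrite mulr2n; ring.
rewrite -[leRHS]ger0_norm ?addr_ge0 ?sqrtr_ge0// -sqrtr_sqr ler_wsqrtr//.
rewrite sqrrD !sqr_sqrtr// lerD2r lerD2l lerMn2r/=.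
rewrite (le_trans (ler_norm _))// -sqrtr_sqr -sqrtrM// ler_wsqrtr//.
exact: CauchySchwarz.
Qed.

HB.instance Definition _ := isMetric.Build R (cube R n)
  cube_distxx cube_dist_eq0 cube_distC cube_dist_triangle.

End cube_metric.

(* Main.v *)
From HB Require Import structures.
Require Import Defs.
From mathcomp Require Import all_boot all_order all_algebra.
From mathcomp Require Import all_classical all_reals all_analysis.
From mathcomp Require Import borel_hierarchy.
From mathcomp Require Import ring lra.
Set Implicit Arguments.
Unset Strict Implicit.
Unset Printing Implicit Defensive.
Import Order.TTheory GRing.Theory Num.Theory.
Import numFieldNormedType.Exports.
Local Open Scope classical_set_scope.
Local Open Scope ring_scope.

(** A set which is a countable union of compact sets [K] has dimension at most
    [n] if and only if each [K] has, for every [e > 0], a finite open cover of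
    mesh [e] and multiplicity [n.+1]; this is the countable sum theorem
    ([covdim_lt_bigcup_compact]) together with its easy converse
    ([covdim_lt_small_cover]). Hence the set of maps in question is the
    intersection, over the pieces [F i] on which [f] is perfect and the meshes
    [1 / m.+1], of the sets [fibrewise_small f (F i) e] of those maps which
    send every fibre of [f] in [F i] to a set having such a cover. These sets
    are open ([fibrewise_small_open]): a cover for one fibre also serves the
    nearby fibres and the nearby maps, and paracompactness of [Y] makes the
    admissible distance continuous. The function space is a Baire space
    ([source_baire]), so it remains to see that they are dense.

    Density ([fibrewise_small_dense]) starts from a grid of small cubes. If a
    compact subset of the cube misses the centres of all the grid cubes, then
    it has a cover of small mesh and of multiplicity [n.+1]
    ([grid_small_cover]); the same holds for any small translate of the grid.
    So it is enough to move a given map [g] slightly in such a way that the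
    image of every fibre misses the centres of some translated grid, which may
    depend on the fibre. For one fibre, whose dimension is at most [n], a map
    into the [n.+1]-cube can be moved off finitely many points by general
    position ([perturb_off_points]), and since [f] is closed on [F i] the
    result is good over a neighbourhood in [Y] ([local_perturbation]).

    Property C glues these local perturbations. Fix translated grids, one for
    each level [k], whose centres have disjoint neighbourhoods, and at level
    [k] move only points with values near the centres of level [k]. Then the
    levels do not interact, so that the covers of [Y] by the sets over which
    the perturbation of level [k] is possible are known beforehand, as property
    C requires. It provides disjoint families, one for each level, which
    together cover [Y]; within a level, disjointness allows a different
    perturbation over each member, and cutting off by functions of [Y] which
    attain the value 1 at every point of [Y] for some level keeps the sum
    continuous. *)

(** * Continuous real-valued functions *)

Lemma continuous_comp_fun (T U V : topologicalType) (f : T -> U) (g : U -> V) :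
  continuous f -> continuous g -> continuous (fun x => g (f x)).
Proof. by move=> cf cg x; apply: continuous_comp; [exact: cf|exact: cg]. Qed.

Section continuous_real.
Context {R : realType} {X : topologicalType}.

Lemma continuous_sumr (J : Type) (s : seq J) (F : J -> X -> R) :
  (forall j, continuous (F j)) -> continuous (fun x => \sum_(j <- s) F j x).
Proof.
move=> cF; elim: s => [|j s IH].
  by under eq_fun do rewrite big_nil; exact: cst_continuous.
under eq_fun do rewrite big_cons.
by move=> x; apply: cvgD; [exact: cF|exact: IH].
Qed.

Lemma continuous_maxr (J : Type) (s : seq J) (F : J -> X -> R) :
  (forall j, continuous (F j)) ->
  continuous (fun x => \big[Num.max/0]_(j <- s) F j x).
Proof.
move=> cF; elim: s => [|j s IH].
  by under eq_fun do rewrite big_nil; exact: cst_continuous.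
under eq_fun do rewrite big_cons.
by move=> x; apply: continuous_max; [exact: cF|exact: IH].
Qed.

Lemma continuous_minr (b : X -> R) (c : R) : continuous b ->
  continuous (fun x => Num.min (b x) c).
Proof. by move=> cb x; apply: continuous_min; [exact: cb|exact: cvg_cst]. Qed.

Lemma continuous_affine (u : X -> R) (a b : R) : continuous u ->
  continuous (fun x => a * u x + b).
Proof.
move=> cu x; apply: cvgD; last exact: cvg_cst.
by apply: cvgM; [exact: cvg_cst|exact: cu].
Qed.

Lemma uniform_approx_continuous (M : pseudoMetricType R) (u : X -> M) :
  (forall e : R, 0 < e ->
    exists v : X -> M, continuous v /\ forall x, ball (v x) e (u x)) ->
  continuous u.
Proof.
move=> H x; apply/cvg_ballP => e e0.
have e3 : 0 < e / 3 by rewrite divr_gt0.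
have [v [cv uv]] := H _ e3.
have /cvg_ballP /(_ _ e3) vx : v x' @[x' --> x] --> v x by exact: cv.
near=> x'; have vxx' : ball (v x) (e / 3) (v x') by near: x'.
have -> : e = e / 3 + (e / 3 + e / 3) by field.
apply: (ball_triangle (ball_sym (uv x))).
exact: (ball_triangle vxx' (uv x')).
Unshelve. all: by end_near.
Qed.

End continuous_real.

(** Where [phi] vanishes the bound on [t] keeps the product small, however
    irregular [t] may be there. *)
Lemma cutoff_continuous (R : realType) (X : topologicalType) (phi t : X -> R)
    (r : R) : continuous phi -> (forall x, `|t x| <= r) ->
  (forall x, phi x != 0 -> exists2 h : X -> R, continuous h &
    \forall x' \near x, t x' = h x') ->
  continuous (fun x => phi x * t x).
Proof.
move=> cphi tr tloc x; have [px|px] := eqVneq (phi x) 0; last first.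
  have [h ch th] := tloc x px.
  have /near_eq_cvg/cvg_trans : \forall x' \near x,
    phi x' * h x' = phi x' * t x'.
    by apply: filterS th => x' ->.
  apply; have -> : phi x * t x = phi x * h x by rewrite (nbhs_singleton th).
  by apply: cvgM; [exact: cphi|exact: ch].
rewrite /continuous_at px mul0r; apply/cvgrPdist_lt => e e0.
have r0 : 0 <= r by exact: le_trans (normr_ge0 _) (tr x).
have r1 : 0 < r + 1 by rewrite ltr_wpDl.
have : \forall x' \near x, `|phi x - phi x'| < e / (r + 1).
  have /cvgrPdist_lt : phi y @[y --> x] --> phi x by exact: cphi.
  by apply; rewrite divr_gt0.
apply: filterS => x'; rewrite px !sub0r !normrN normrM ltr_pdivlMr// => px'.
apply: le_lt_trans px'; apply: ler_wpM2l => //.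
by apply: le_trans (tr x') _; rewrite lerDl.
Qed.

Section metric_continuity.
Context {R : realType} {Z : metricType R}.

Lemma continuous_short (u : Z -> R) :
  (forall x y, `|u x - u y| <= mdist x y) -> continuous u.
Proof.
move=> su x; apply/cvgrPdist_lt => e e0; apply/nbhs_ballP; exists e => // y.
by rewrite ballEmdist /= => xy; exact: le_lt_trans (su x y) xy.
Qed.

Lemma continuous_mdistP (X : topologicalType) (g : X -> Z) :
  (forall x (e : R), 0 < e -> \forall y \near x, mdist (g x) (g y) < e) ->
  continuous g.
Proof.
move=> H x; apply/cvg_ballP => e e0; have := H x e e0.
by apply: filterS => y; rewrite ballEmdist.
Qed.

End metric_continuity.

Lemma open_forall (T : topologicalType) (I : finType) (P : I -> set T) :
  (forall i, open (P i)) -> open [set x | forall i, P i x].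
Proof.
move=> oP; rewrite openE => x Px; apply: filter_forall => i.
by apply: open_nbhs_nbhs; split; [exact: oP|exact: Px].
Qed.

Lemma open_dist_lt (R : realType) (a r : R) : open [set t : R | `|t - a| < r].
Proof.
rewrite (_ : [set _ | _] = ball a r); first exact: ball_open.
by apply/seteqP; split => t; rewrite -ball_normE /= distrC.
Qed.

(** * Paracompact and normal spaces *)

Lemma setI0_absurd {T : Type} {A B : set T} {x : T} :
  A `&` B = set0 -> A x -> B x -> False.
Proof. by move=> AB Ax Bx; rewrite -[False]/(set0 x) -AB. Qed.

Section paracompact_normal.
Context {T : topologicalType}.
Implicit Types (A B G U V : set T) (W : set (set T)).

(** Closures commute with locally finite unions; only finitely many members
    matter near any given point. *)
Lemma locally_finite_closed_bigcup (V : set (set T)) :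
  locally_finite V -> closed (\bigcup_(B in V) closure B).
Proof.
move=> lfV p clp; have [N Np finN] := lfV p.
pose D := [set B | V B /\ B `&` N !=set0].
have cD : closed (\bigcup_(B in D) closure B).
  by apply: closed_bigcup => // B _; exact: closed_closure.
suff : (\bigcup_(B in D) closure B) p by move=> [B [VB _] Bp]; exists B.
apply: cD => M Mp.
have /clp[q [[B VB Bq] [/nbhs_interior Nq Mq]]] : nbhs p (N° `&` M).
  by apply: filterI => //; exact: nbhs_interior.
exists q; split => //; exists B => //; split => //.
have [r [Br /interior_subset Nr]] := Bq _ Nq.
by exists r; split => //; exact: nbhs_singleton.
Qed.

Lemma locally_finiteS (V W : set (set T)) : W `<=` V -> locally_finite V ->
  locally_finite W.
Proof.
move=> WV lfV x; have [N Nx finN] := lfV x; exists N => //.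
by apply: sub_finite_set finN => B [/WV].
Qed.

(** Cover [A] by sets having [P] and the rest of the space by the complement of
    [A]; the members of a locally finite refinement which have [P] still cover
    [A]. *)
Lemma paracompact_locally_finite (P : set T -> Prop) A :
  paracompact T -> closed A ->
  (forall B C : set T, B `<=` C -> P C -> P B) ->
  (forall a, A a -> exists G : set T, [/\ open G, G a & P G]) ->
  exists W, [/\ W `<=` open, W `<=` P, A `<=` \bigcup_(B in W) B &
                locally_finite W].
Proof.
move=> [_ pT] cA hP AP.
pose U := [set V : set T | open V /\ (P V \/ V `<=` ~` A)].
have oU : open_cover U.
  split=> [V []//|]; rewrite -subTset => x _.
  have [Ax|nAx] := pselect (A x).
    by have [V [oV Vx PV]] := AP _ Ax; exists V => //; split => //; left.
  by exists (~` A) => //; split; [exact: closed_openC|right].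
have [V [[oV cV] rV lfV]] := pT _ oU.
exists [set B | V B /\ P B]; split.
- by move=> B [/oV].
- by move=> B [].
- move=> a Aa; have [B VB Ba] : (\bigcup_(B in V) B) a by rewrite cV.
  exists B => //; split => //; have [C [oC CP] BC] := rV _ VB.
  by case: CP => [|CA]; [exact: hP|have := CA _ (BC _ Ba)].
- by apply: locally_finiteS lfV => B [].
Qed.

(** This is used twice: with [B] a point it gives regularity, and then, with
    [B] closed, normality. *)
Lemma paracompact_separation A B : paracompact T -> closed A ->
  (forall a, A a -> exists G : set T, [/\ open G, G a &
    closure G `&` B = set0]) ->
  exists G, [/\ open G, A `<=` G & closure G `&` B = set0].
Proof.
move=> pT cA AB.
have [] := @paracompact_locally_finite
  (fun V => closure V `&` B = set0) A pT cA.
- move=> U V UV VB; rewrite -subset0 -VB => x [Ux Bx].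
  by split => //; exact: closureS Ux.
- exact: AB.
move=> W [oW WP AW lfW]; exists (\bigcup_(B in W) B); split => //.
  exact: bigcup_open.
have clW := locally_finite_closed_bigcup lfW.
rewrite -subset0 => x [Gx Bx].
have : closure (\bigcup_(B in W) closure B) x.
  apply: closureS Gx => y [C WC Cy]; exists C => //; exact: subset_closure.
rewrite -(closure_id _).1// => -[C /WP CB Cx].
exact: setI0_absurd CB Cx Bx.
Qed.

Lemma paracompact_normal : paracompact T -> normal_space T.
Proof.
move=> pT; have hT := pT.1.
have regular A y : closed A -> ~ A y ->
    exists V : set T, [/\ open V, V y & closure V `&` A = set0].
  move=> cA Ay.
  have [a Aa|G [oG AG Gy]] := @paracompact_separation A [set y] pT cA.
    have [Aya|ya] := eqVneq y a; first by rewrite Aya in Ay.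
    move: (hT); rewrite open_hausdorff =>
      /(_ _ _ ya)[[U V] /= [/set_mem Uy /set_mem Va] [oU oV /eqP UV]].
    exists V; split => //; rewrite -subset0 => x [clV xy]; rewrite {}xy in clV.
    have [z [Vz Uz]] := clV _ (open_nbhs_nbhs (conj oU Uy)).
    exact: setI0_absurd UV Uz Vz.
  exists (~` closure G); split; first exact/closed_openC/closed_closure.
    by move=> Gy'; exact: setI0_absurd Gy Gy' _.
  rewrite -subset0 => a [clG /AG Ga].
  have [z [Gz1 Gz2]] := clG _ (open_nbhs_nbhs (conj oG Ga)).
  by apply: Gz1; exact: subset_closure.
move=> A cA B /set_nbhsP[C [oC AC CB]].
have [a Aa|G [oG AG GB]] := @paracompact_separation A (~` C) pT cA.
  by apply: regular; [exact: open_closedC|move=> /(_ (AC _ Aa))].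
exists G; first by apply/set_nbhsP; exists G; split.
move=> x Gx; apply: CB; apply: contrapT => Cx.
exact: setI0_absurd GB Gx Cx.
Qed.

(** [D k] collects the closures, contained in [O k], of members of a locally
    finite refinement; local finiteness makes [D k] closed. *)
Lemma paracompact_countable_shrinking (O : nat -> set T) : paracompact T ->
  (forall k, open (O k)) -> \bigcup_k O k = setT ->
  exists D : nat -> set T,
    [/\ forall k, closed (D k), forall k, D k `<=` O k & \bigcup_k D k = setT].
Proof.
move=> pT oO cO; have nT := paracompact_normal pT.
have [] := @paracompact_locally_finite
  (fun V => exists k, closure V `<=` O k) setT pT closedT.
- by move=> U V UV [k Vk]; exists k; exact: subset_trans (closureS UV) Vk.
- move=> a _; have [k _ Oa] : (\bigcup_k O k) a by rewrite cO.
  have : set_nbhs [set a] (O k).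
    by apply/set_nbhsP; exists (O k); split => // _ ->.
  have /(nT _) : closed [set a].
    by apply: accessible_closed_set1; exact: hausdorff_accessible pT.1.
  move=> /[apply] -[V /set_nbhsP[C [oC aC CV]] clV].
  exists C; split => //; first exact: aC.
  by exists k; exact: subset_trans (closureS CV) clV.
move=> W [oW WP TW lfW].
exists (fun k => \bigcup_(B in [set B | W B /\ closure B `<=` O k]) closure B).
split.
- move=> k; apply: locally_finite_closed_bigcup.
  by apply: locally_finiteS lfW => B [].
- by move=> k x [B [_]]; exact.
- rewrite -subTset => x _; have [B WB Bx] := TW x I.
  have [k Bk] := WP _ WB; exists k => //; exists B => //; exact: subset_closure.
Qed.

End paracompact_normal.

Section bump.
Context {R : realType} {T : topologicalType}.

Lemma normal_bump (A U : set T) : normal_space T -> closed A -> open U ->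
  A `<=` U -> exists u : T -> R, [/\ continuous u, forall x, 0 <= u x <= 1,
    forall x, u x != 0 -> U x & forall x, A x -> u x = 1].
Proof.
move=> nT cA oU AU.
have UA : ~` U `&` A = set0 by rewrite -subset0 => x [Ux /AU].
have [u [cu u0 u1 u01]] := @urysohn_ext_itv _ R nT _ _ _ _
  (open_closedC oU) cA UA ltr01.
exists u; split => //.
- by move=> x; have := u01 (u x) (ex_intro2 _ _ x I erefl); rewrite /= in_itv.
- by move=> x ux; apply: contrapT => Ux; move: ux; rewrite (u0 (u x)) ?eqxx//;
    exists x.
- by move=> x Ax; apply: u1; exists x.
Qed.

Lemma paracompact_countable_bumps (O : nat -> set T) : paracompact T ->
  (forall k, open (O k)) -> \bigcup_k O k = setT ->
  exists phi : nat -> T -> R,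
    [/\ forall k, continuous (phi k), forall k x, 0 <= phi k x <= 1,
        forall k x, phi k x != 0 -> O k x & forall x, exists k, phi k x = 1].
Proof.
move=> pT oO cO.
have [D [cD DO TD]] := paracompact_countable_shrinking pT oO cO.
have /choice[phi phiP] k :=
  normal_bump (paracompact_normal pT) (cD k) (oO k) (DO k).
exists phi; split; first by move=> k; have [] := phiP k.
- by move=> k; have [] := phiP k.
- by move=> k; have [] := phiP k.
- move=> x; have [k _ Dx] : (\bigcup_k D k) x by rewrite TD.
  by exists k; have [_ _ _] := phiP k; exact.
Qed.

(** A local choice of admissible radii can be made continuous: if [phi k] is
    supported where the radius [2^-k] is admissible, then so is the supremum of
    the [phi k x * 2^-k], because every nonzero term is bounded by the first
    admissible power. *)
Lemma paracompact_continuous_radius (good : T -> R -> Prop) : paracompact T ->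
  (forall x (d d' : R), 0 < d' -> d' <= d -> good x d -> good x d') ->
  (forall x : T, exists2 d : R, 0 < d & \forall y \near x, good y d) ->
  exists a : T -> R,
    [/\ continuous a, forall x, 0 < a x & forall x, good x (a x)].
Proof.
move=> pT mono locg; pose e k : R := 2^-1 ^+ k.
have e_gt0 k : 0 < e k by rewrite exprn_gt0.
have e_le m k : (m <= k)%N -> e k <= e m.
  by move=> mk; apply: ler_wiXn2l => //; rewrite invf_le1// ler1n.
have e_small d : 0 < d -> exists k, e k < d.
  move=> d0; have := @cvg_geometric R 1 2^-1.
  rewrite ger0_norm ?invf_lt1 ?ltr1n// => /(_ isT) /cvgrPdist_lt /(_ _ d0).
  case=> k _ /(_ k (leqnn k)) /=.
  by rewrite sub0r normrN /geometric /= mul1r ger0_norm ?(ltW (e_gt0 _))//;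
    exists k.
pose O k := [set x | good x (e k)]°.
have oO k : open (O k) by exact: open_interior.
have cO : \bigcup_k O k = setT.
  rewrite -subTset => x _; have [d d0 gd] := locg x;
    have [k kd] := e_small _ d0.
  exists k => //; rewrite /O /interior; apply: filterS gd => y.
  by apply: mono => //; exact: ltW.
have [phi [cphi phi01 phiO phi1]] := paracompact_countable_bumps pT oO cO.
pose t k x := phi k x * e k.
have t0 k x : 0 <= t k x.
  by rewrite mulr_ge0 ?(ltW (e_gt0 _))//; have /andP[] := phi01 k x.
have te k x : t k x <= e k.
  by rewrite ler_piMl ?(ltW (e_gt0 _))//; have /andP[] := phi01 k x.
pose a x := sup (range (t ^~ x)).
have ub x : has_ubound (range (t^~ x)).
  by exists (e 0) => _ [k _ <-]; exact: le_trans (te k x) (e_le _ _ _).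
have ta k x : t k x <= a x by apply: ub_le_sup => //; exists k.
have a_ge0 x : 0 <= a x by exact: le_trans (t0 0%N x) (ta _ _).
exists a; split.
- apply: uniform_approx_continuous => r r0.
  have [k kr] := e_small _ r0.
  exists (fun x => \big[Num.max/0]_(j < k) t j x); split.
    by apply: continuous_maxr => j x; apply: cvgM; [exact: cphi|exact: cvg_cst].
  move=> x; rewrite /ball /=; set v := \big[_/_]_(_ < _) _.
  have va : v <= a x.
    by rewrite /v; elim/big_ind: _ => //= p q pa qa; rewrite ge_max pa.
  have v0 : 0 <= v.
    by rewrite /v; elim/big_ind: _ => //= p q p0 q0; rewrite le_max p0.
  rewrite ler0_norm ?subr_le0// opprB ltrBlDr.
  apply: (@le_lt_trans _ _ (e k + v)); last by rewrite ltrD2r.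
  apply: ge_sup; first by exists (t 0%N x); exists 0%N.
  move=> _ [j _ <-]; have [jk|kj] := ltnP j k.
    rewrite -[leLHS]add0r lerD ?(ltW (e_gt0 _))//.
    exact: (le_bigmax _ (fun i : 'I_k => t i x) (Ordinal jk)).
  by rewrite -[leLHS]addr0 lerD// (le_trans (te j x))// e_le.
- move=> x; have [k p1] := phi1 x.
  by apply: lt_le_trans (ta k x); rewrite /t p1 mul1r.
- move=> x; have [k0 p1] := phi1 x.
  have exk : exists k, phi k x != 0 by exists k0; rewrite p1 oner_neq0.
  pose k := ex_minn exk; have kP : phi k x != 0 by rewrite /k; case: ex_minnP.
  have kmin j : phi j x != 0 -> (k <= j)%N.
    by rewrite /k; case: ex_minnP => m _; exact.
  have ax : 0 < a x.
    by apply: lt_le_trans (ta k0 x); rewrite /t p1 mul1r.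
  apply: (mono _ (e k)) => //; last exact: interior_subset (phiO _ _ kP).
  apply: ge_sup; first by exists (t 0%N x); exists 0%N.
  move=> _ [j _ <-]; have [pj|pj] := eqVneq (phi j x) 0.
    by rewrite /t pj mul0r ltW.
  by apply: le_trans (te j x) _; exact/e_le/kmin.
Qed.

End bump.

Section normal_finite.
Context {T : topologicalType}.

Lemma normal_closure_sep (A U : set T) : normal_space T -> closed A -> open U ->
  A `<=` U -> exists G, [/\ open G, A `<=` G & closure G `<=` U].
Proof.
move=> nT cA oU AU; have : set_nbhs A U by apply/set_nbhsP; exists U; split.
move=> /(nT _ cA)[V /set_nbhsP[G [oG AG GV]] VU].
by exists G; split => //; exact: subset_trans (closureS GV) VU.
Qed.

(** The members are shrunk one at a time: the points which belong to no other
    member form a closed set inside the current one. *)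
Lemma normal_finite_shrinking (J : finType) (U : J -> set T) : normal_space T ->
  (forall j, open (U j)) -> (forall x, exists j, U j x) ->
  exists V : J -> set T, [/\ forall j, open (V j),
    forall j, closure (V j) `<=` U j & forall x, exists j, V j x].
Proof.
move=> nT oU cU.
suff [V [oV VU clV cV]] : exists V : J -> set T, [/\ forall j, open (V j),
    forall j, V j `<=` U j, forall j, j \in enum J -> closure (V j) `<=` U j &
    forall x, exists j, V j x].
  by exists V; split => // j; apply: clV; rewrite mem_enum.
elim: (enum J) => [|i s [V [oV VU clV cV]]].
  by exists U; split=> // j; exact: subset_refl.
pose A := ~` \bigcup_(j in [set j | j != i]) V j.
have cA : closed A by apply: open_closedC; exact: bigcup_open.
have AV : A `<=` V i.
  move=> x Ax; have [j Vx] := cV x; have [<-//|ji] := eqVneq j i.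
  by exfalso; apply: Ax; exists j.
have [G [oG AG GV]] := normal_closure_sep nT cA (oV i) AV.
exists (fun j => if j == i then G else V j); split.
- by move=> j; case: ifP.
- move=> j; case: eqP => [->|_]; last exact: VU.
  by apply: subset_trans (VU i); apply: subset_trans GV; exact: subset_closure.
- move=> j; rewrite inE; case: eqP => [-> _|_ /=]; last exact: clV.
  exact: subset_trans GV (VU i).
- move=> x; have [Ax|] := pselect (A x); first by exists i; rewrite eqxx;
    exact: AG.
  by move=> /contrapT[j /= ji Vx]; exists j; rewrite (negbTE ji).
Qed.

Lemma normal_partition_of_unity (R : realType) (J : finType) (U : J -> set T) :
  normal_space T -> (forall j, open (U j)) -> (forall x, exists j, U j x) ->
  exists phi : J -> T -> R, [/\ forall j, continuous (phi j),
    forall j x, 0 <= phi j x, forall x, \sum_j phi j x = 1 &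
    forall j x, phi j x != 0 -> U j x].
Proof.
move=> nT oU cU.
have [V [_ VU cV]] := normal_finite_shrinking nT oU cU.
have /choice[u uP] j :=
  @normal_bump R _ _ _ nT (@closed_closure _ (V j)) (oU j) (VU j).
have u0 j x : 0 <= u j x by have [_ /(_ x)/andP[]] := uP j.
pose s x := \sum_j u j x.
have s_gt0 x : 0 < s x.
  have [j Vx] := cV x; rewrite /s (bigD1 j)//= ltr_wpDr ?sumr_ge0//.
  by have [_ _ _ ->//] := uP j; exact: subset_closure.
have cs : continuous s by apply: continuous_sumr => i; have [] := uP i.
exists (fun j x => u j x / s x); split.
- move=> j x; apply: cvgM; first by have [cu _ _ _] := uP j; exact: cu.
  apply: cvgV; first by rewrite gt_eqF.
  exact: cs.
- by move=> j x; rewrite divr_ge0// ltW.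
- by move=> x; rewrite -mulr_suml -/(s x) divff// gt_eqF.
- move=> j x ux; have [_ _ /(_ x) + _] := uP j; apply.
  by apply: contraNneq ux => ->; rewrite mul0r.
Qed.

End normal_finite.

(** * Closed maps and compact fibres *)

(** The hypothesis concerns closed sets of the subspaces [F] and [f @` F]; it
    passes to [Y] because [f @` F] is closed there. *)
Lemma perfect_restriction_closed (X Y : topologicalType) (f : X -> Y)
    (F A : set X) : perfect_map (sigLR [fun f in F]) -> closed (f @` F) ->
  closed A -> closed (f @` (F `&` A)).
Proof.
move=> [_ clf _] cfF cA.
have cA' : closed (set_val @^-1` A : set F).
  by apply: preimage_closed => // x _; exact: initial_continuous.
have /closed_openC[B oB BE] := clf _ cA'.
suff -> : f @` (F `&` A) = f @` F `&` ~` B.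
  by apply: closedI => //; exact: open_closedC.
have Bf y : B (set_val y) <-> ~ (sigLR [fun f in F] @` (set_val @^-1` A)) y.
  by rewrite -[~ _]/((~` _) y) -BE.
apply/seteqP; split => [_ [x [Fx Ax] <-]|_ [[x Fx <-] nB]].
  split; first by exists x.
  pose x' : F := SigSub (mem_set Fx).
  move=> Bfx; have /Bf := (Bfx : B (set_val (sigLR [fun f in F] x'))).
  by apply; exists x'.
pose x' : F := SigSub (mem_set Fx).
have : (sigLR [fun f in F] @` (set_val @^-1` A)) (sigLR [fun f in F] x').
  by apply: contrapT => /Bf.
move=> [[z Fz] /= Az /(congr1 set_val) /= zx].
by exists z; [split => //; exact/set_mem|].
Qed.

(** The points of [F] outside [N] form a closed set, whose image is closed and
    misses [y]. *)
Lemma perfect_restriction_tube (X Y : topologicalType) (f : X -> Y)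
    (F N : set X) (y : Y) :
  perfect_map (sigLR [fun f in F]) -> closed (f @` F) -> open N ->
  F `&` f @^-1` [set y] `<=` N ->
  exists W, [/\ open W, W y & F `&` f @^-1` W `<=` N].
Proof.
move=> pf cfF oN FN.
exists (~` (f @` (F `&` ~` N))); split.
- exact/closed_openC/perfect_restriction_closed/open_closedC.
- by move=> [x [Fx Nx] fx]; apply: Nx; exact: FN.
- by move=> x [Fx Wx]; apply: contrapT => Nx; apply: Wx; exists x.
Qed.

Section perfect_fibres.
Context {X Y : topologicalType}.

Lemma perfect_restriction_fibre_compact (f : X -> Y) (F : set X) (y : Y) :
  perfect_map (sigLR [fun f in F]) -> compact (F `&` f @^-1` [set y]).
Proof.
move=> [_ _ cpf]; have [[x [Fx fx]]|nF] :=
  pselect (F `&` f @^-1` [set y] !=set0); last first.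
  rewrite (_ : F `&` _ = set0); first exact: compact0.
  by apply/eqP; apply: contrapT => /negP/set0P.
have fy : (f @` F) y by exists x.
pose y' : f @` F := SigSub (mem_set fy).
rewrite (_ : F `&` _ = set_val @` (sigLR [fun f in F] @^-1` [set y'])).
  apply: continuous_compact; last exact: cpf.
  by apply: continuous_subspaceT; exact: initial_continuous.
apply/seteqP; split => [z [Fz fz]|_ [z zy <-]].
  by exists (SigSub (mem_set Fz)) => //=; apply: val_inj.
split; first exact: set_valP.
by have := congr1 set_val zy.
Qed.

Lemma compact_positive_lower_bound (R : realType) (K : set X) (a : X -> R) :
  compact K -> continuous a -> (forall x, 0 < a x) ->
  exists2 d : R, 0 < d & forall x, K x -> d < a x.
Proof.
move=> /compact_near_coveringP cK ca a0.
have : \forall d \near (0:R)^'+, K `<=` (fun x => d < a x).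
  apply: cK => x _.
  have ax2 : a x / 2 < a x by rewrite ltr_pdivrMr// ltr_pMr// ltr1n.
  exists ([set y | a x / 2 < a y], [set d | d < a x / 2]).
    split => /=; last by apply: nbhs_right_lt; rewrite divr_gt0.
    by have /cvgr_gt/(_ _ ax2) : a y @[y --> x] --> a x by exact: ca.
  by move=> [y d] /= [ya da]; exact: lt_trans ya.
move=> H; have : \forall d \near (0:R)^'+, 0 < d /\ K `<=` (fun x => d < a x).
  by apply: filterI => //; exact: nbhs_right_gt.
by move=> /filter_ex[d [d0 dK]]; exists d.
Qed.

End perfect_fibres.

(** * Covering dimension with indexed covers *)

Section indexed_covers.

(** Bounding the number of indices rather than the number of distinct members
    makes regrouping and shrinking of families immediate. *)
Definition order_le {T : Type} {J : finType} (A : set T) (V : J -> set T)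
    (k : nat) :=
  forall x, A x -> forall S : {set J}, (forall j, j \in S -> V j x) ->
    (#|S| <= k)%N.

Lemma order_leS {T : Type} {J : finType} (A B : set T) (V W : J -> set T)
    (k : nat) : A `<=` B -> (forall j, A `&` V j `<=` W j) ->
  order_le B W k -> order_le A V k.
Proof.
move=> AB VW oW x Ax S VS; apply: (oW x (AB _ Ax)) => j /VS Vjx.
by apply: VW.
Qed.

(** A point that lies in the groups of several indices lies in as many distinct
    members, one from each group. *)
Lemma order_le_group {T : Type} {J I : finType} (A : set T) (V : J -> set T)
    (c : J -> option I) (k : nat) : order_le A V k ->
  order_le A (fun i => \bigcup_(j in [set j | c j = Some i]) V j) k.
Proof.
move=> oV x Ax S VS.
have /choice[b bP] (i : I) : exists j : option J, i \in S ->
    exists j', [/\ j = Some j', c j' = Some i & V j' x].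
  have [iS|iS] := boolP (i \in S); last by exists None.
  by have [j cj Vj] := VS _ iS; exists (Some j) => _; exists j.
pose S' := finset (fun j => Some j \in b @: S).
have <- : #|S'| = #|S|.
  rewrite -(card_imset S' (@Some_inj _)) -[RHS](@card_in_imset _ _ b).
    apply: eq_card => o; apply/imsetP/idP => [[j]|];
      first by rewrite inE => jS ->.
    move=> ob; case/imsetP: (ob) => i iS oE.
    have [j [bj _ _]] := bP _ iS.
    by exists j; rewrite ?inE -?bj -?oE.
  move=> i i' iS iS' bb.
  have [j [bj cj _]] := bP _ iS; have [j' [bj' cj' _]] := bP _ iS'.
  by move: bj'; rewrite -bb bj => -[jj]; move: cj'; rewrite -jj cj => -[].
apply: (oV x Ax) => j; rewrite inE => /imsetP[i iS jb].
by have [j' [bj' _ Vj']] := bP _ iS; move: jb; rewrite bj' => -[->].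
Qed.

(** The members of the refinement are grouped by a chosen member of [U] that
    contains them. *)
Lemma covdim_lt_finType (T : topologicalType) (k : nat) (J : finType)
    (U : J -> set T) : covdim_lt T k -> (forall j, open (U j)) ->
  (forall x, exists j, U j x) ->
  exists V : J -> set T, [/\ forall j, open (V j), forall j, V j `<=` U j,
    forall x, exists j, V j x & order_le setT V k].
Proof.
move=> dT oU cU.
have [||W [finW [oW cW] rW multW]] := dT (range U).
- by apply: finite_image; exact: finite_finset.
- split=> [_ [j _ <-]//|]; rewrite -subTset => x _.
  by have [j Ux] := cU x; exists (U j).
have /choice[c cP] (B : set T) : exists o : option J, W B ->
    exists2 j, o = Some j & B `<=` U j.
  have [WB|WB] := pselect (W B); last by exists None.
  by have [_ [j _ <-] BU] := rW _ WB; exists (Some j) => _; exists j.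
pose V j := \bigcup_(B in [set B | W B /\ c B = Some j]) B.
exists V; split.
- by move=> j; apply: bigcup_open => B [/oW].
- by move=> j x [B [/cP[i ->] BU [<-]]]; exact: BU.
- move=> x; have [B WB Bx] : (\bigcup_(B in W) B) x by rewrite cW.
  by have [j cB BU] := cP _ WB; exists j; exists B.
- move=> x _ S VS.
  have /choice[b bP] (j : J) : exists B : set T, j \in S ->
      [/\ W B, c B = Some j & B x].
    have [jS|jS] := boolP (j \in S); last by exists set0.
    by have [B [WB cB] Bx] := VS _ jS; exists B.
  have finx : finite_set [set B | W B /\ B x].
    by apply: sub_finite_set finW => B [].
  apply: leq_trans (geq_card_fset_set (multW x)).
  rewrite cardE -(size_map b); apply: uniq_leq_size.
    rewrite map_inj_in_uniq ?enum_uniq// => i j; rewrite !mem_enum => iS jS bij.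
    have [_ ci _] := bP _ iS; have [_ cj _] := bP _ jS.
    by move: cj; rewrite -bij ci => -[].
  move=> _ /mapP[j + ->]; rewrite mem_enum => /bP[WB _ Bx].
  by rewrite in_fset_set// inE.
Qed.

Lemma covdim_lt_ord (T : topologicalType) (k : nat) :
  (forall (p : nat) (U : 'I_p -> set T), (forall j, open (U j)) ->
    (forall x, exists j, U j x) ->
    exists V : 'I_p -> set T, [/\ forall j, open (V j), forall j, V j `<=` U j,
      forall x, exists j, V j x & order_le setT V k]) ->
  covdim_lt T k.
Proof.
move=> H W /finite_seqP[s WE] [oW cW].
pose U (j : 'I_(size s)) := tnth (in_tuple s) j.
have UW j : W (U j) by rewrite WE /=; exact: mem_tnth.
have [||V [oV VU cV mV]] := H _ U.
- by move=> j; exact/oW/UW.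
- move=> x; have [B WB Bx] : (\bigcup_(B in W) B) x by rewrite cW.
  move: WB; rewrite WE => /= Bs.
  by have /tnthP[j BE] : B \in in_tuple s by []; exists j; rewrite /U -BE.
exists (range V); split.
- by apply: finite_image; exact: finite_finset.
- split=> [_ [j _ <-]//|]; rewrite -subTset => x _.
  by have [j Vx] := cV x; exists (V j).
- by move=> _ [j _ <-]; exists (U j).
- move=> x; pose S := finset (fun j => `[< V j x >]).
  have Sk : (#|S| <= k)%N by apply: (mV x I) => j; rewrite inE => /asboolP.
  apply: (@card_le_trans _ _ _ `I_(#|S|)); last by rewrite card_le_II.
  pose b i := oapp V set0 (nth None [seq Some j | j <- enum S] i).
  apply: card_le_trans (card_image_le b `I_(#|S|)).
  apply: subset_card_le => _ [[j _ <-] Vx].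
  have jS : j \in enum S by rewrite mem_enum inE; exact/asboolP.
  exists (index j (enum S)); first by rewrite /= cardE index_mem.
  by rewrite /b (nth_map j) ?index_mem// nth_index.
Qed.

(** The infimum that defines the dimension is taken over integers, so it is at
    most [n] only if one of them is. *)
Lemma covdim_leP (R : realType) (T : topologicalType) (n : nat) :
  (covdim R T <= n%:R%:E)%E <-> covdim_lt T n.+1.
Proof.
split=> [|dT]; last first.
  by apply: ereal_inf_lbound; exists n.+1 => //; rewrite -natr1 addrK.
move=> dn; apply: contrapT => ndT.
have : ((n.+1%:R)%:E <= covdim R T)%E.
  apply: le_ereal_inf_tmp => _ [k dk <-]; rewrite lee_fin lerBrDr natr1 ler_nat.
  rewrite leqNgt; apply/negP => kn; apply: ndT => U fU oU.
  have [V [fV oV rV mV]] := dk _ fU oU; exists V; split => // x.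
  by apply: card_le_trans (mV x) _; rewrite card_le_II.
move=> /le_trans /(_ dn); rewrite lee_fin ler_nat.
by rewrite ltnn.
Qed.

End indexed_covers.

(** The refinement is taken for the cover of [K] by the [U j] and the
    complement of [L]; the part that refines the complement is dropped. *)
Lemma covdim_lt_subset (X : topologicalType) (K L : set X) (k : nat)
    (J : finType) (U : J -> set X) : covdim_lt K k -> closed L -> L `<=` K ->
  (forall j, open (U j)) -> (forall x, L x -> exists j, U j x) ->
  exists V : J -> set X, [/\ forall j, open (V j), forall j, V j `<=` U j,
    forall x, L x -> exists j, V j x & order_le L V k].
Proof.
move=> dK cL LK oU cU.
pose U' (o : option J) : set K := set_val @^-1` (oapp U (~` L) o).
have [||V' [oV' V'U cV' mV']] :=
  covdim_lt_finType dK (_ : forall o, open (U' o)).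
- by move=> o; exists (oapp U (~` L) o) => //; case: o => //=;
    exact: closed_openC.
- move=> x; have [/cU[j Ux]|nL] := pselect (L (set_val x));
    first by exists (Some j).
  by exists None.
have /choice[G GP] o : exists G : set X, open G /\ set_val @^-1` G = V' o.
  by have [G oG GV] := oV' o; exists G.
exists (fun j => G (Some j) `&` U j); split.
- by move=> j; apply: openI => //; have [] := GP (Some j).
- by move=> j x [].
- move=> x Lx; pose x' : K := SigSub (mem_set (LK _ Lx)).
  have [[j|] Vx] := cV' x'; last by have := V'U _ _ Vx; rewrite /U' /=.
  exists j; split; last exact: (V'U _ _ Vx).
  by move: Vx; have [_ <-] := GP (Some j).
- move=> x Lx S VS; pose x' : K := SigSub (mem_set (LK _ Lx)).
  rewrite -(card_imset S (@Some_inj _));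
    apply: (mV' x' I) => _ /imsetP[j jS ->].
  by have [_ <-] := GP (Some j); have [] := VS _ jS.
Qed.

(** * The countable sum theorem *)

Section countable_sum.
Context {T : topologicalType}.

(** Outside [K] the given cover is kept, on [K] the refinement is used, and the
    final shrinking carries the bound over to closures. This is one step of the
    countable sum theorem. *)
Lemma normal_shrink_on_closed (K : set T) (k : nat) (J : finType)
    (U V : J -> set T) : normal_space T -> closed K ->
  (forall j, open (U j)) -> (forall x, exists j, U j x) ->
  (forall j, open (V j)) -> (forall j, V j `<=` U j) ->
  (forall x, K x -> exists j, V j x) -> order_le K V k ->
  exists W : J -> set T, [/\ forall j, open (W j),
    forall j, closure (W j) `<=` U j, forall x, exists j, W j x &
    order_le K (closure \o W) k].
Proof.
move=> nT cK oU cU oV VU cV mV.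
pose U' j := U j `&` (V j `|` ~` K).
have [||W [oW WU' cW]] :=
  normal_finite_shrinking nT (_ : forall j, open (U' j)).
- by move=> j; apply: openI => //; apply: openU => //; exact: closed_openC.
- move=> x; have [Kx|Kx] := pselect (K x).
    by have [j Vx] := cV _ Kx; exists j; split; [exact: VU|left].
  by have [j Ux] := cU x; exists j; split => //; right.
exists W; split => //.
- by move=> j x /WU'[].
- apply: order_leS mV => // j x [Kx /WU'[_ []//]].
Qed.

(** Nested shrinkings [W i] are controlled on [K i]; the intersections of their
    closures still cover because the index type is finite. *)
Lemma normal_countable_sum (K : nat -> set T) (k : nat) (J : finType)
    (U : J -> set T) : normal_space T ->
  (forall i, closed (K i)) -> \bigcup_i K i = setT ->
  (forall i (U : J -> set T),
    (forall j, open (U j)) -> (forall x, exists j, U j x) ->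
    exists V : J -> set T, [/\ forall j, open (V j), forall j, V j `<=` U j,
      forall x, K i x -> exists j, V j x & order_le (K i) V k]) ->
  (forall j, open (U j)) -> (forall x, exists j, U j x) ->
  exists C : J -> set T, [/\ forall j, closed (C j), forall j, C j `<=` U j,
    forall x, exists j, C j x & order_le setT C k].
Proof.
move=> nT cK KT dK oU cU.
pose cover (V : J -> set T) :=
  (forall j, open (V j)) /\ forall x, exists j, V j x.
have /choice[next nextP] (q : nat * (J -> set T)) : exists W : J -> set T,
    cover q.2 -> [/\ cover W, forall j, closure (W j) `<=` q.2 j &
    order_le (K q.1) (closure \o W) k].
  have [[oV cV]|nV] := pselect (cover q.2); last by exists q.2.
  have [V' [oV' V'V cV' mV']] := dK q.1 _ oV cV.
  have [W [oW WV cW mW]] :=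
    normal_shrink_on_closed nT (cK _) oV cV oV' V'V cV' mV'.
  by exists W => _; split.
pose W := fix W i := if i is i'.+1 then next (i', W i') else U.
have cW i : cover (W i) by elim: i => // i IH; have [] := nextP (i, W i) IH.
have clW i j : closure (W i.+1 j) `<=` W i j.
  by have [_ + _] := nextP (i, W i) (cW i); exact.
have decW m i j : (m <= i)%N -> W i j `<=` W m j.
  elim: i => [|i IH]; first by rewrite leqn0 => /eqP ->.
  rewrite leq_eqVlt => /predU1P[->//|/IH]; apply: subset_trans.
  by apply: subset_trans (clW _ _); exact: subset_closure.
exists (fun j => \bigcap_i closure (W i.+1 j)); split.
- by move=> j; apply: closed_bigI => i _; exact: closed_closure.
- by move=> j x /(_ 0%N I) /clW.
- move=> x; apply: contrapT => nC.
  have /choice[i iP] (j : J) : exists i, ~ W i.+1 j x.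
    apply: contrapT => nW; apply: nC; exists j => i _.
    by apply: subset_closure; apply: contrapT => Wx; apply: nW; exists i.
  have [j] := (cW (\max_j i j).+1).2 x.
  have ij : ((i j).+1 <= (\max_j i j).+1)%N by rewrite ltnS; exact: leq_bigmax.
  by move=> /(decW _ _ _ ij)/iP.
- move=> x _ S CS; have [i _ Kx] : (\bigcup_i K i) x by rewrite KT.
  have [_ _ mW] := nextP (i, W i) (cW i).
  by apply: (mW x Kx) => j jS; exact: CS.
Qed.

End countable_sum.

Section metric_covers.
Context {R : realType} {Z : metricType R}.

(** Every point of [C j] gets the radius [rho], within which it sees only
    members containing it; among the centres whose half-radius balls meet at a
    point, the one with largest radius lies in all the members concerned. *)
Lemma closed_family_swelling (A : set Z) (J : finType) (C : J -> set A)
    (W : J -> set Z) (k : nat) :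
  (forall j, closed (C j)) -> order_le setT C k ->
  (forall j, open (W j)) -> (forall j x, C j x -> W j (set_val x)) ->
  exists V : J -> set Z, [/\ forall j, open (V j), forall j, V j `<=` W j,
    forall j x, C j x -> V j (set_val x) & order_le setT V k].
Proof.
move=> cC mC oW CW.
have /choice[rho rhoP] (x : A) : exists r : R, 0 < r /\
    forall j y, C j y -> mdist (set_val x) (set_val y) < r -> C j x.
  have /choice[r rP] (j : J) : exists r : R, 0 < r /\
      forall y, C j y -> mdist (set_val x) (set_val y) < r -> C j x.
    have [Cx|Cx] := pselect (C j x); first by exists 1.
    have /nbhs_ballP[r /= r0 rC] : nbhs x (~` C j).
      by apply: open_nbhs_nbhs; split => //; exact: closed_openC.
    exists r; split => // y Cy xy; exfalso; apply: (rC y) => //.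
    by rewrite -initial_ballE /= ballEmdist.
  exists (\big[Num.min/1]_j r j); split.
    by elim/big_ind: _ => // [p q p0 q0|j _];
      [rewrite lt_min p0|have [] := rP j].
  move=> j y Cy xy; have [_] := rP j; apply; first exact: Cy.
  by apply: lt_le_trans xy _; exact: bigmin_le.
pose V j := W j `&` \bigcup_(x in C j) (ball (set_val x) (rho x / 2))°.
have rho2 x : 0 < rho x / 2 by rewrite divr_gt0//; have [] := rhoP x.
exists V; split.
- move=> j; apply: openI => //; apply: bigcup_open => x _.
  exact: open_interior.
- by move=> j z [].
- move=> j x Cx; split; first exact: CW.
  by exists x => //; exact: nbhsx_ballx.
- move=> z _ S VS; have [->|[i iS]] := set_0Vmem S; first by rewrite cards0.
  have /choice[x xP] (j : J) : exists x : A, j \in S ->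
      C j x /\ ball (set_val x) (rho x / 2) z.
    have [jS|] := boolP (j \in S); last by have [_ [x _ _]] := VS _ iS;
      exists x.
    by have [_ [x Cx /interior_subset xz]] := VS _ jS; exists x.
  pose m := [arg max_(j > i in S) rho (x j)]%O.
  have [mS mmax] : m \in S /\ forall j, j \in S -> rho (x j) <= rho (x m).
    by rewrite /m; case: arg_maxP.
  apply: (mC (x m) I) => j jS; have [Cj xjz] := xP _ jS;
    have [Cm xmz] := xP _ mS.
  have [_ /(_ j (x j) Cj)] := rhoP (x m); apply.
  have := ball_triangle xmz (ball_sym xjz);
    rewrite ballEmdist /= => /lt_le_trans.
  by apply; rewrite [leRHS]splitr lerD2l ler_pM2r// mmax.
Qed.

Definition small_cover (e : R) (k : nat) (K : set Z) :=
  exists (J : finType) (V : J -> set Z), [/\ forall j, open (V j),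
    forall j x y, V j x -> V j y -> mdist x y < e,
    forall x, K x -> exists j, V j x & order_le setT V k].

Lemma small_coverS (e : R) (k : nat) (K L : set Z) :
  K `<=` L -> small_cover e k L -> small_cover e k K.
Proof.
by move=> KL [J [V [oV dV cV mV]]]; exists J, V; split => // x /KL/cV.
Qed.

(** A refinement consists of open sets of the subspace [A]; shrinking them to
    closed sets and swelling these gives open sets of [Z] with the same
    multiplicity. *)
Lemma covdim_lt_small_cover (A : set Z) (e : R) (k : nat) (J : finType)
    (B : J -> set Z) : (forall j, open (B j)) ->
  (forall j x y, B j x -> B j y -> mdist x y < e) ->
  (forall x, exists j, B j x) -> covdim_lt A k -> small_cover e k A.
Proof.
move=> oB dB cB dA.
have nA : normal_space A by exact: (@pseudometric_normal R A).
have oBA j : open (set_val @^-1` B j : set A) by exists (B j).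
have cBA (x : A) : exists j, (set_val @^-1` B j : set A) x by exact: cB.
have [U [oU UB cU mU]] := covdim_lt_finType dA oBA cBA.
have [C [oC CU cC]] := normal_finite_shrinking nA oU cU.
have [||||V [oV VB CV mV]] := @closed_family_swelling A J (closure \o C) B k.
- by move=> j; exact: closed_closure.
- by apply: order_leS mU => // j x [_ /CU].
- by [].
- by move=> j x /CU/UB.
exists J, V; split => //.
- by move=> j x y /VB Bx /VB; exact: dB.
- move=> x Ax; pose x' : A := SigSub (mem_set Ax).
  by have [j Cx] := cC x'; exists j; apply: (CV j x'); exact: subset_closure.
Qed.

Lemma compact_lebesgue_number (K : set Z) (J : finType) (O : J -> set Z) :
  compact K -> (forall j, open (O j)) -> (forall x, K x -> exists j, O j x) ->
  exists2 e : R, 0 < e & forall x, K x -> exists j, ball x e `<=` O j.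
Proof.
move=> /compact_near_coveringP cK oO cO.
have : \forall e \near (0:R)^'+, K `<=` (fun x => exists j, ball x e `<=` O j).
  apply: cK => x Kx; have [j Ox] := cO _ Kx.
  have /nbhs_ballP[r /= r0 rO] : nbhs x (O j) by exact: open_nbhs_nbhs.
  exists (ball x (r / 2), [set e | e < r / 2]).
    split => /=; first by apply: nbhsx_ballx; rewrite divr_gt0.
    by apply: nbhs_right_lt; rewrite divr_gt0.
  move=> [y e] /= [xy er]; exists j => z yz; apply: rO.
  by rewrite (splitr r); apply: ball_triangle xy _; exact: (le_ball (ltW er)).
move=> H; have : \forall e \near (0:R)^'+, 0 < e /\
    K `<=` (fun x => exists j, ball x e `<=` O j).
  by apply: filterI => //; exact: nbhs_right_gt.
by move=> /filter_ex[e [e0 eK]]; exists e.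
Qed.

(** By the Lebesgue number, a fine enough cover of the compact set [K i]
    refines a given one. The sum theorem combines these refinements into a
    closed cover of [A], which is then swollen to an open one. *)
Lemma covdim_lt_bigcup_compact (A : set Z) (K : nat -> set Z) (k : nat) :
  (forall i, compact (K i)) -> A = \bigcup_i K i ->
  (forall i (e : R), 0 < e -> small_cover e k (K i)) -> covdim_lt A k.
Proof.
move=> cK AK sK; apply: covdim_lt_ord => p U oU cU.
have nA : normal_space A by exact: (@pseudometric_normal R A).
have hZ : hausdorff_space Z by exact: metric_hausdorff.
have lift (V : 'I_p -> set A) : (forall j, open (V j)) ->
    exists G : 'I_p -> set Z, forall j, open (G j) /\ set_val @^-1` G j = V j.
  move=> oV; have /choice[G GP] j : exists G : set Z,
      open G /\ set_val @^-1` G = V j.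
    by have [G oG GV] := oV j; exists G.
  by exists G.
pose K' i : set A := set_val @^-1` K i.
have cK' i : closed (K' i).
  apply: preimage_closed; last exact: compact_closed.
  by move=> x _; exact: initial_continuous.
have K'T : \bigcup_i K' i = setT.
  rewrite -subTset => x _.
  have [i _ Kx] : (\bigcup_i K i) (set_val x) by rewrite -AK; exact: set_valP.
  by exists i.
have dK i (V : 'I_p -> set A) : (forall j, open (V j)) ->
    (forall x, exists j, V j x) ->
    exists V' : 'I_p -> set A, [/\ forall j, open (V' j),
      forall j, V' j `<=` V j, forall x, K' i x -> exists j, V' j x &
      order_le (K' i) V' k].
  move=> oV cV; have [G GP] := lift _ oV.
  have [||e e0 eK] := @compact_lebesgue_number (K i) _ G (cK i).
  - by move=> j; have [] := GP j.
  - move=> x Kx.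
    have Ax : A x by rewrite AK; exists i.
    have [j] := cV (SigSub (mem_set Ax)).
    by have [_ <-] := GP j; exists j.
  have [L [B [oB dB cB mB]]] := sK i e e0.
  have /choice[c cP] (l : L) : exists o : option 'I_p, B l `&` K i !=set0 ->
      exists2 j, o = Some j & B l `<=` G j.
    have [[x [Bx Kx]]|nBK] := pselect (B l `&` K i !=set0); last by exists None.
    have [j jO] := eK _ Kx; exists (Some j) => _; exists j => // y By.
    by apply: jO; rewrite ballEmdist; exact: dB By.
  pose c' l := if `[< B l `&` K i !=set0 >] then c l else None.
  exists (fun j => set_val @^-1` (\bigcup_(l in [set l | c' l = Some j]) B l)).
  split.
  - move=> j; exists (\bigcup_(l in [set l | c' l = Some j]) B l) => //.
    exact: bigcup_open.
  - move=> j x [l]; rewrite /c' /=; case: asboolP => // /cP[j' -> BG] [<-] /BG.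
    by have [_ <-] := GP j'.
  - move=> x Kx; have [l Bx] := cB _ Kx.
    have BK : B l `&` K i !=set0 by exists (set_val x).
    have [j cj _] := cP _ BK; exists j; exists l => //.
    by rewrite /c' /=; case: asboolP.
  - move=> x _ S VS.
    by apply: (@order_le_group _ _ _ setT B c' k mB (set_val x) I).
have [C [cC CU covC mC]] := normal_countable_sum nA cK' K'T dK oU cU.
have [G GP] := lift _ oU.
have [|j x /CU|V [oV VG CV mV]] :=
  closed_family_swelling cC mC (_ : forall j, open (G j)).
- by move=> j; have [] := GP j.
- by have [_ <-] := GP j.
exists (fun j => set_val @^-1` V j); split.
- by move=> j; exists (V j).
- by move=> j x /VG; have [_ <-] := GP j.
- by move=> x; have [j /CV] := covC x; exists j.
- by move=> x _ S VS; exact: (mV (set_val x) I).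
Qed.

End metric_covers.

(** * The Euclidean cube *)

Section cube_coordinates.
Context {R : realType} {d : nat}.
Implicit Types x y : cube R d.

Definition coord x (i : 'I_d) : R := val x ord0 i.

Lemma coord01 x i : 0 <= coord x i <= 1.
Proof. by rewrite /coord; have /forallP/(_ i) := valP x. Qed.

Lemma cube_of_coords (c : 'I_d -> R) : (forall i, 0 <= c i <= 1) ->
  exists x : cube R d, forall i, coord x i = c i.
Proof.
move=> c01; have cP : [forall i, 0 <= (\row_i c i) ord0 i <= 1].
  by apply/forallP => i; rewrite mxE.
by exists (Sub (\row_i c i) cP) => i; rewrite /coord SubK mxE.
Qed.

Lemma coord_dist_le x y i : `|coord x i - coord y i| <= mdist x y.
Proof.
rewrite -sqrtr_sqr; apply: ler_wsqrtr.
rewrite (bigD1 i)//= lerDl; apply: sumr_ge0 => j _; exact: sqr_ge0.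
Qed.

Lemma cube_dist_le x y (e : R) : (forall i, `|coord x i - coord y i| <= e) ->
  mdist x y <= d%:R * e.
Proof.
move=> xye; have [d0|d0] := posnP d.
  have -> : mdist x y = Num.sqrt (\sum_i (coord x i - coord y i) ^+ 2) by [].
  rewrite big1 ?sqrtr0 ?d0 ?mul0r// => i.
  by have := ltn_ord i; rewrite {2}d0.
have e0 : 0 <= e by exact: le_trans (normr_ge0 _) (xye (Ordinal d0)).
have -> : d%:R * e = Num.sqrt ((d%:R * e) ^+ 2).
  by rewrite sqrtr_sqr ger0_norm ?mulr_ge0.
apply: ler_wsqrtr.
apply: (@le_trans _ _ (\sum_(i < d) e ^+ 2)).
  apply: ler_sum => i _; rewrite -real_normK ?num_real// ler_pXn2r ?nnegrE//.
  exact: xye.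
rewrite sumr_const card_ord -[leLHS]mulr_natl exprMn.
apply: ler_wpM2r; rewrite ?sqr_ge0//.
by rewrite expr2 -natrM ler_nat leq_pmulr.
Qed.

Lemma coord_continuous i : continuous (coord^~ i).
Proof. by apply: continuous_short => x y; exact: coord_dist_le. Qed.

Lemma continuous_cube (X : topologicalType) (g : X -> cube R d) :
  (forall i, continuous (fun t : X => coord (g t) i)) -> continuous g.
Proof.
move=> cg; apply: continuous_mdistP => x e e0.
have d1 : 0 < d%:R + 1 :> R by rewrite ltr_wpDl.
have : \forall t \near x, forall i,
    `|coord (g x) i - coord (g t) i| <= e / (d%:R + 1).
  apply: filter_forall => i.
  have /cvgrPdist_le : coord (g t) i @[t --> x] --> coord (g x) i by exact: cg.
  by apply; rewrite divr_gt0.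
apply: filterS => t /cube_dist_le xx'.
apply: le_lt_trans xx' _; rewrite mulrCA gtr_pMr// ltr_pdivrMr// mul1r.
by rewrite ltrDl.
Qed.

Lemma open_coords (P : 'I_d -> set R) : (forall i, open (P i)) ->
  open [set x : cube R d | forall i, P i (coord x i)].
Proof.
move=> oP; apply: open_forall => i; apply: open_comp => // x _.
exact: coord_continuous.
Qed.

(** The cube is totally bounded: cut it along a fine grid. *)
Lemma cube_finite_cover (e : R) : 0 < e ->
  exists (J : finType) (B : J -> set (cube R d)), [/\ forall j, open (B j),
    forall j x y, B j x -> B j y -> mdist x y < e & forall x, exists j, B j x].
Proof.
move=> e0; pose r := e / (2 * d%:R + 1).
have d1 : 0 < 2 * d%:R + 1 :> R by rewrite ltr_wpDl// mulr_ge0.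
have r0 : 0 < r by rewrite divr_gt0.
pose N := (Num.bound r^-1).
have rN : r^-1 < N%:R by apply: archi_boundP; rewrite invr_ge0 ltW.
exists {ffun 'I_d -> 'I_N.+1}.
exists (fun a : {ffun 'I_d -> 'I_N.+1} =>
  [set x | forall i, (`|coord x i - (a i)%:R * r| < r)%R]).
split.
- move=> a.
  have oP i : open [set t : R | `|t - (a i)%:R * r| < r] by exact: open_dist_lt.
  exact: (open_coords oP).
- move=> a x y ax ay; apply: (@le_lt_trans _ _ (d%:R * (r + r))).
    apply: cube_dist_le => i;
      have := ler_distD ((a i)%:R * r) (coord x i) (coord y i).
    move=> /le_trans; apply; apply: ltW; apply: ltrD; first exact: ax.
    by rewrite distrC; exact: ay.
  rewrite (_ : _ * (r + r) = e * (2 * d%:R / (2 * d%:R + 1)));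
    last by rewrite /r; field; rewrite gt_eqF.
  by rewrite gtr_pMr// ltr_pdivrMr// mul1r ltrDl.
- move=> x.
  have tr i : (Num.truncn (coord x i / r) < N.+1)%N.
    have /andP[x0 x1] := coord01 x i.
    rewrite ltnS -(ler_nat R); have := truncn_itv (divr_ge0 x0 (ltW r0)).
    move=> /andP[/le_trans tl _]; apply: tl; apply: le_trans (ltW rN).
    by rewrite ler_piMl// invr_ge0 ltW.
  exists [ffun i => Ordinal (tr i)] => i; rewrite ffunE /=.
  have /andP[x0 x1] := coord01 x i.
  have /andP[t1 t2] := truncn_itv (divr_ge0 x0 (ltW r0)).
  move: t1 t2; rewrite ler_pdivlMr// ltr_pdivrMr// -natr1 mulrDl mul1r.
  by move=> t1 t2; rewrite ger0_norm ?subr_ge0// ltrBlDl.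
Qed.

Lemma cube_complete (u : nat -> cube R d) (e : nat -> R) :
  (forall j k, (j <= k)%N -> mdist (u j) (u k) <= e j) ->
  e @ \oo --> (0 : R) -> exists z, forall k, mdist (u k) z <= d%:R * e k.
Proof.
move=> ue e0.
have ui i : exists l : R, 0 <= l <= 1 /\ forall k, `|coord (u k) i - l| <= e k.
  have ue' j k : (j <= k)%N -> `|coord (u j) i - coord (u k) i| <= e j.
    by move=> /ue; exact: le_trans (coord_dist_le _ _ _).
  have cu : cvgn (fun k => coord (u k) i).
    apply/cauchy_cvgP; apply: cauchy_exP => r r0.
    have /cvgrPdist_lt /(_ r r0)[N _ Nr] := e0.
    exists (coord (u N) i), N => // k /= Nk; rewrite /ball /=.
    apply: le_lt_trans (ue' _ _ Nk) _.
    by have := Nr N (leqnn N); rewrite /= sub0r normrN;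
      exact: le_lt_trans (ler_norm _).
  exists (limn (fun k => coord (u k) i)); split.
    apply/andP; split; [apply: limr_ge|apply: limr_le] => //; near=> k.
      by have /andP[] := coord01 (u k) i.
    by have /andP[] := coord01 (u k) i.
  move=> k; rewrite ler_distlC; apply/andP; split.
    apply: limr_ge => //; exists k => // m /= km.
    by have := ue' _ _ km; rewrite ler_distlC => /andP[].
  apply: limr_le => //; exists k => // m /= km.
  by have := ue' _ _ km; rewrite ler_distlC => /andP[].
have /choice[l lP] := ui.
have [i|z zl] := @cube_of_coords l; first by have [] := lP i.
exists z => k; apply: cube_dist_le => i; rewrite zl.
by have [_] := lP i; exact.
Unshelve. all: by end_near.
Qed.

End cube_coordinates.

(** * Fine covers of compact sets missing the centres of a grid *)

Section grid.
Context {R : realType}.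

(** The boolean is the dimension of the cell: an integer point thickened by
    [t], or a unit interval shortened by [t] at both ends. *)
Definition line_cell (t : R) (l : nat * bool) : set R :=
  [set u | if l.2 then l.1%:R + t < u /\ u < l.1%:R + 1 - t
           else `|u - l.1%:R| < t].

Lemma line_cell_open (t : R) l : open (line_cell t l).
Proof.
case: l => b [] /=; last exact: open_dist_lt.
rewrite (_ : line_cell _ _ =
  [set u | b%:R + t < u] `&` [set u | u < b%:R + 1 - t])//.
by apply: openI; [exact: open_gt|exact: open_lt].
Qed.

Lemma line_cell_inj (t u : R) (l l' : nat * bool) : 0 < t -> t < 1 / 2 ->
  line_cell t l u -> line_cell t l' u -> l = l'.
Proof.
move=> t0 t2; have aux (b b' : nat) (o o' : bool) :
    line_cell t (b, o) u ->
    line_cell t (b', o') u -> (b <= b')%N -> (b, o) = (b', o').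
  rewrite /line_cell /= => bu bu'; rewrite leq_eqVlt => /predU1P[bb'|].
    subst b'; congr pair; case: o o' bu bu' => -[] //=.
      by move=> [? ?]; rewrite ltr_norml => /andP[? ?]; lra.
    by rewrite ltr_norml => /andP[? ?] [? ?]; lra.
  rewrite -(ler_nat R) -natr1 => bb'; exfalso; move: bu bu'.
  case: o; case: o' => /=; rewrite ?ltr_norml.
  - by move=> [? ?] [? ?]; lra.
  - by move=> [? ?] /andP[? ?]; lra.
  - by move=> /andP[? ?] [? ?]; lra.
  - by move=> /andP[? ?] /andP[? ?]; lra.
case: l l' => b o [b' o'] bu bu'; have [bb|/ltnW bb] := leqP b b'.
  exact: aux bu bu' bb.
by symmetry; exact: aux bu' bu bb.
Qed.

Lemma line_cell_width (t u v : R) l : 0 < t -> t < 1 / 2 ->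
  line_cell t l u -> line_cell t l v -> `|u - v| <= 1.
Proof.
case: l => b o t0 t2; rewrite /line_cell /= ler_distl; case: o.
  by move=> [? ?] [? ?]; lra.
by rewrite !ltr_norml => /andP[? ?] /andP[? ?]; lra.
Qed.

Lemma near_integer (u : R) : 0 <= u -> (forall b : nat, u != b%:R + 1 / 2) ->
  exists b : nat, `|u - b%:R| < 1 / 2.
Proof.
move=> u0 nu; have /andP[] := truncn_itv u0; set b := Num.truncn u.
rewrite -natr1 => bu ub; have := nu b; rewrite neq_lt => /orP[ub2|ub2].
  by exists b; rewrite ltr_norml; apply/andP; split; lra.
by exists b.+1; rewrite -natr1 ltr_norml; apply/andP; split; lra.
Qed.

(** The first [k] such that [#|F k| <= k] satisfies [k <= #|F k.-1|], which
    forces equality since the sets grow. Below, [F k] is the set of coordinates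
    at distance at least [theta k] from the integers, and [F k = F k.-1]
    excludes that one of them is at distance exactly [theta k]. *)
Lemma threshold_fixpoint (I : finType) (F : nat -> {set I}) (n : nat) :
  (forall k, F k \subset F k.+1) -> (#|F n| <= n)%N ->
  exists k, [/\ (k <= n)%N, #|F k| = k & (k > 0)%N -> F k = F k.-1].
Proof.
move=> mF Fn; have exk : exists k, (#|F k| <= k)%N by exists n.
pose k := ex_minn exk.
have [Fk kmin] : (#|F k| <= k)%N /\ forall j, (#|F j| <= j)%N -> (k <= j)%N.
  by rewrite /k; case: ex_minnP.
exists k; split; first exact: kmin.
  case: k Fk kmin => [|k] Fk kmin; first by apply/eqP; rewrite -leqn0.
  apply/eqP; rewrite eqn_leq Fk/=; apply: leq_trans (subset_leq_card (mF k)).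
  by rewrite ltnNge; apply/negP => /kmin; rewrite ltnn.
case: k Fk kmin => // k Fk kmin _ /=; apply/esym/eqP; rewrite eqEcard mF /=.
apply: leq_trans Fk _.
by rewrite ltnNge; apply/negP => /kmin; rewrite ltnn.
Qed.

(** A point with [k] coordinates far from the integers is put in a cell that is
    a thickened [k]-dimensional face of the grid. For fixed [k] these cells are
    pairwise disjoint. By compactness every point of [K] has a coordinate
    within some [t < 1/2] of an integer, so that only [k <= n] occur, and the
    multiplicity is at most [n.+1]. The threshold [theta k] beyond which a
    coordinate counts as far decreases with [k]; this makes the cells open
    without losing the covering property. *)
Lemma grid_small_cover (n M : nat) (s e : R) (K : set (cube R n.+1)) :
  (0 < M)%N -> 0 <= s -> compact K ->
  (forall x, K x -> exists i, forall b : nat,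
    M%:R * coord x i + s != b%:R + 1 / 2) ->
  n.+1%:R / M%:R < e -> small_cover e n.+1 K.
Proof.
move=> M0 s0 cK Khalf Me; have M0' : 0 < M%:R :> R by rewrite ltr0n.
pose u (x : cube R n.+1) i := M%:R * coord x i + s.
have u_ge0 x i : 0 <= u x i.
  by rewrite addr_ge0// mulr_ge0//; have /andP[] := coord01 x i.
have cu i : continuous (u^~ i).
  exact: continuous_affine (@coord_continuous _ _ i).
have [t [t0 t2 tK]] : exists t : R, [/\ 0 < t, t < 1 / 2 &
    forall x, K x -> exists i (b : nat), `|u x i - b%:R| < t].
  move: cK => /compact_near_coveringP cK.
  have : \forall t \near ((1 / 2 : R)^'-),
      K `<=` (fun x => exists i (b : nat), `|u x i - b%:R| < t).
    apply: cK => x Kx; have [i ui] := Khalf x Kx.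
    have [b ub] := near_integer (u_ge0 x i) ui.
    pose t0 := (`|u x i - b%:R| + 1 / 2) / 2.
    have ut0 : `|u x i - b%:R| < t0 by rewrite /t0; lra.
    have t02 : t0 < 1 / 2 by rewrite /t0; lra.
    exists ([set y | `|u y i - b%:R| < t0], [set t | t0 < t]).
      split => /=; last exact: nbhs_left_gt.
      apply: open_nbhs_nbhs; split => //.
      exact: (@open_comp _ _ (u^~ i) _ (in1W (cu i)) (@open_dist_lt _ b%:R t0)).
    by move=> [y t] /= [yt tt]; exists i, b; exact: lt_trans tt.
  move=> H; have : \forall t \near ((1 / 2 : R)^'-), (0 < t /\ t < 1 / 2) /\
      K `<=` (fun x => exists i (b : nat), `|u x i - b%:R| < t).
    apply: filterI => //; apply: filterI; last exact: nbhs_left_lt.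
    by apply: nbhs_left_gt; lra.
  by move=> /filter_ex[t [[t0 t2] tK]]; exists t.
pose theta (k : nat) : R := t + (1 / 2 - t) * 2^-1 ^+ k.+1.
have half_gt0 k : 0 < (2^-1 : R) ^+ k by rewrite exprn_gt0.
have th_gt k : t < theta k by rewrite /theta ltrDl mulr_gt0// subr_gt0.
have th_gt0 k : 0 < theta k by exact: lt_trans (th_gt k).
have th_lt k : theta k < 1 / 2.
  have : (1 / 2 - t) * 2^-1 ^+ k.+1 < 1 / 2 - t.
    by rewrite gtr_pMr ?subr_gt0// exprn_ilt1// invf_lt1// ltr1n.
  by rewrite /theta; lra.
have th_dec k : theta k.+1 < theta k.
  rewrite /theta ltrD2l ltr_pM2l ?subr_gt0// exprS gtr_pMl//.
  by rewrite invf_lt1// ltr1n.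
pose N := (Num.bound (M%:R + s + 2)).
have uN x i : u x i + 2 < N%:R.
  apply: le_lt_trans (archi_boundP _); last by rewrite !addr_ge0.
  rewrite lerD2r lerD2r ler_piMr//.
  by have /andP[] := coord01 x i.
pose L := {ffun 'I_n.+1 -> 'I_N * bool}.
pose dimL (l : L) := #|finset (fun i => (l i).2)|.
pose lab (l : L) i : nat * bool := (nat_of_ord (l i).1, (l i).2).
pose E (l : L) : set (cube R n.+1) := [set x | (dimL l <= n)%N /\
  forall i, line_cell (theta (dimL l)) (lab l i) (u x i)].
exists L, E; split.
- move=> l; have [ln|ln] := leqP (dimL l) n; last first.
    rewrite (_ : E l = set0); first exact: open0.
    by rewrite -subset0 => x [+ _]; rewrite leqNgt ln.
  rewrite (_ : E l = [set x | forall i,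
    (u^~ i @^-1` line_cell (theta (dimL l)) (lab l i)) x]).
    apply: open_forall => i.
    exact: (@open_comp _ _ (u^~ i) _ (in1W (cu i)) (@line_cell_open _ _)).
  by apply/seteqP; split => [x []|x ?].
- move=> l x y [_ lx] [_ ly]; apply: le_lt_trans Me.
  apply: cube_dist_le => i; rewrite -(ler_pM2l M0') divff ?gt_eqF//.
  rewrite -{1}(ger0_norm (ltW M0')) -normrM mulrBr.
  have := line_cell_width (th_gt0 _) (th_lt _) (lx i) (ly i).
  by rewrite /u opprD addrACA subrr addr0.
- move=> x Kx.
  pose F k := finset (fun i =>
    `[< forall b : nat, theta k <= `|u x i - b%:R| >]).
  have FS k : F k \subset F k.+1.
    apply/fintype.subsetP => i; rewrite !inE => /asboolP Fi; apply/asboolP => b.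
    exact: le_trans (ltW (th_dec k)) (Fi b).
  have Fn : (#|F n| <= n)%N.
    have [i [b ub]] := tK x Kx.
    have iF : i \notin F n.
      by rewrite inE; apply/asboolP => /(_ b); rewrite leNgt (lt_trans ub).
    have := max_card (mem (i |: F n)); rewrite cardsU1 iF card_ord.
    by rewrite add1n ltnS.
  have [k [kn Fk Fk1]] := threshold_fixpoint FS Fn.
  have Fstrict i : i \in F k -> forall b : nat, theta k < `|u x i - b%:R|.
    case: k kn Fk Fk1 => [_ /eqP|k _ _ /(_ isT) -> /=].
      by rewrite cards_eq0 => /eqP -> _; rewrite finset.in_set0.
    rewrite inE => /asboolP Fi b; exact: lt_le_trans (th_dec k) (Fi b).
  have /choice[l lP] i : exists l : 'I_N * bool, l.2 = (i \in F k) /\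
      line_cell (theta k) (nat_of_ord l.1, l.2) (u x i).
    have [iF|iF] := boolP (i \in F k).
      have /andP[] := truncn_itv (u_ge0 x i); set b := Num.truncn _.
      rewrite -natr1 => bu ub.
      have bN : (b < N)%N by rewrite -(ltr_nat R); have := uN x i; lra.
      exists (Ordinal bN, true); split => //=; rewrite /line_cell /=.
      have := Fstrict i iF b; have := Fstrict i iF b.+1.
      rewrite -natr1 ler0_norm ?[in X in _ -> X]ger0_norm; [|lra|lra].
      by move=> ? ?; split; lra.
    move: iF; rewrite inE => /asboolP/existsNP[b /negP]; rewrite -ltNge => ub.
    have bN : (b < N)%N.
      by rewrite -(ltr_nat R); move: ub; have := uN x i; have := th_lt k;
        rewrite ltr_norml; lra.
    by exists (Ordinal bN, false).
  exists [ffun i => l i]; have dl : dimL [ffun i => l i] = k.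
    rewrite -Fk; apply: eq_card => i; rewrite !inE ffunE.
    by have [-> _] := lP i; rewrite inE.
  split; rewrite dl// => i; rewrite /lab ffunE; by have [] := lP i.
- move=> x _ S ES.
  pose k (l : L) : 'I_n.+1 := inord (dimL l).
  rewrite -(card_in_imset (f := k)).
    by apply: leq_trans (max_card _) _; rewrite card_ord.
  move=> l l' /ES[ln lx] /ES[ln' lx'] /(congr1 val).
  rewrite /= !inordK// => ll'; apply/ffunP => i.
  have := line_cell_inj (th_gt0 _) (th_lt _) (lx i) _.
  rewrite ll' => /(_ _ (lx' i)) [] /val_inj.
  by case: (l i) (l' i) => b o [b' o'] /= -> ->.
Qed.

End grid.

(** * The Baire property of the source limitation topology *)

Section source_baire.
Context {R : realType} {X : topologicalType}.

Definition mk_source {Z : metricType R} (g : X -> Z) (cg : continuous g) :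
    source_lim X Z :=
  HB.pack_for (continuousType X Z) g (@isContinuous.Build X Z g cg).

Lemma source_continuous {Z : metricType R} (g : source_lim X Z) : continuous g.
Proof. exact: cts_fun. Qed.

Lemma mdist_continuous2 {Z : metricType R} (g h : source_lim X Z) :
  continuous (fun x => mdist (g x) (h x)).
Proof.
move=> x; apply/cvgrPdist_lt => e e0.
have e2 : 0 < e / 2 by rewrite divr_gt0.
have gx : \forall y \near x, ball (g x) (e / 2) (g y).
  by apply: (source_continuous (g := g)); exact: nbhsx_ballx.
have hx : \forall y \near x, ball (h x) (e / 2) (h y).
  by apply: (source_continuous (g := h)); exact: nbhsx_ballx.
near=> y.
have : ball (g x) (e / 2) (g y) by near: y.
have : ball (h x) (e / 2) (h y) by near: y.
rewrite !ballEmdist /= => hxy gxy.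
have t1 := metric_triangle (g x) (g y) (h x).
have t2 := metric_triangle (g y) (h y) (h x).
have t3 := metric_triangle (g y) (g x) (h y).
have t4 := metric_triangle (g x) (h x) (h y).
have := metric_sym (h x) (h y); have := metric_sym (g x) (g y).
by rewrite ltr_norml => s1 s2; apply/andP; split; lra.
Unshelve. all: by end_near.
Qed.

Lemma source_openE {Z : metricType R} (U : set (source_lim X Z)) :
  open U = source_open U.
Proof. by []. Qed.

Lemma source_ball_open {Z : metricType R} (g : source_lim X Z) (a : X -> R) :
  continuous a ->
  open [set h : source_lim X Z | forall x, mdist (g x) (h x) < a x].
Proof.
rewrite source_openE => ca h /= gh;
  exists (fun x => (a x - mdist (g x) (h x)) / 2); split.
- move=> x; apply: cvgM; last exact: cvg_cst.
  by apply: cvgB; [exact: ca|exact: mdist_continuous2].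
- by move=> x; rewrite divr_gt0// subr_gt0.
- move=> k hk x; have := metric_triangle (g x) (h x) (k x).
  by have := hk x; have := gh x; lra.
Qed.

(** Nested closed balls whose radius functions are bounded by [2^-k] contain
    the uniform limit of their centres, which exists because the cube is
    complete. *)
Lemma source_baire (d : nat) (U : nat -> set (source_lim X (cube R d))) :
  (forall k, open (U k)) -> (forall k, dense (U k)) -> dense (\bigcap_k U k).
Proof.
move=> oU dU V [g0 Vg0] oV; pose S := source_lim X (cube R d).
pose good (p : S * (X -> R)) := continuous p.2 /\ forall x, 0 < p.2 x.
pose e (k : nat) : R := 2^-1 ^+ k.
have e_gt0 k : 0 < e k by rewrite exprn_gt0.
have e_cvg : e @ \oo --> (0 : R).
  by apply: cvg_expr; rewrite ger0_norm ?invf_lt1 ?ltr1n.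
have /choice[next nextP] (q : nat * (S * (X -> R))) :
    exists p : S * (X -> R), good q.2 -> [/\ good p, forall x, p.2 x <= e q.1,
      source_cball p.1 p.2 `<=` U q.1 &
      source_cball p.1 p.2 `<=` source_cball q.2.1 q.2.2].
  case: q => k [g a]; have [[ca a0]|?] := pselect (good (g, a));
    last by exists (g, a).
  pose B := [set h : S | forall x, mdist (g x) (h x) < a x].
  have oB : open B by exact: source_ball_open.
  have [|g' [Bg' Ug']] := dU k B _ oB.
    by exists g => x; rewrite mdistxx.
  have oBU : source_open (B `&` U k) by rewrite -source_openE; exact: openI.
  have [b [cb b0 bU]] := oBU _ (conj Bg' Ug').
  exists (g', fun x => Num.min (b x) (e k)) => _; split => /=.
  - split=> /= [|x]; last by rewrite lt_min b0 e_gt0.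
    exact: continuous_minr cb.
  - by move=> x; rewrite ge_min lexx orbT.
  - move=> h /= gh; have [] // : (B `&` U k) h.
    by apply: bU => x; apply: le_trans (gh x) _; rewrite ge_min lexx.
  - move=> h /= gh; have [Bh _] : (B `&` U k) h.
      by apply: bU => x; apply: le_trans (gh x) _; rewrite ge_min lexx.
    by move=> x; exact/ltW/Bh.
rewrite source_openE in oV; have [a0 [ca0 a00 a0V]] := oV _ Vg0.
pose p := fix p k := if k is k'.+1 then next (k', p k') else (g0, a0).
have gp k : good (p k) by elim: k => // k IH; have [] := nextP (k, p k) IH.
pose B k := source_cball (p k).1 (p k).2.
have BS k : B k.+1 `<=` B k by have [] := nextP (k, p k) (gp k).
have BU k : B k.+1 `<=` U k by have [] := nextP (k, p k) (gp k).
have Bdec j k : (j <= k)%N -> B k `<=` B j.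
  elim: k => [|k IH]; first by rewrite leqn0 => /eqP ->.
  by rewrite leq_eqVlt => /predU1P[->//|/IH]; apply: subset_trans.
have pe k x : (p k.+1).2 x <= e k.
  by have [_ + _ _] := nextP (k, p k) (gp k); exact.
have Bc k : B k (p k).1 by move=> x; rewrite mdistxx ltW//; have [_] := gp k.
have pBk j k x : (j <= k)%N -> mdist ((p j).1 x) ((p k).1 x) <= (p j).2 x.
  by move=> jk; exact: (Bdec _ _ jk _ (Bc k) x).
have /choice[z zP] x : exists z : cube R d,
    forall k, mdist ((p k.+1).1 x) z <= d%:R * e k.
  apply: (@cube_complete _ _ (fun k => (p k.+1).1 x)) e_cvg => j k jk.
  exact: le_trans (pBk _ _ _ _) (pe _ _).
have de_cvg r : 0 < r -> exists N, forall k, (N <= k)%N -> d%:R * e k < r.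
  move=> r0; have : (fun k => d%:R * e k) @ \oo --> (d%:R * 0 : R).
    by apply: cvgM => //; exact: cvg_cst.
  rewrite mulr0 => /cvgrPdist_lt/(_ r r0)[N _ Nr]; exists N => k /Nr /=.
  by rewrite sub0r normrN; exact: le_lt_trans (ler_norm _).
have cz : continuous z.
  apply: uniform_approx_continuous => r r0; have [N Nr] := de_cvg _ r0.
  exists (p N.+1).1; split; first exact: source_continuous.
  by move=> x; rewrite ballEmdist /=;
    exact: le_lt_trans (zP _ _) (Nr N (leqnn N)).
have Bz k : B k (mk_source cz).
  move=> x; apply/ler_addgt0Pr => r r0; have [N Nr] := de_cvg _ r0.
  pose m := maxn k N.
  apply: le_trans (metric_triangle _ ((p m.+1).1 x) _) _; apply: lerD.
    by apply: pBk; rewrite leqW// leq_maxl.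
  by apply: le_trans (zP x m) _; apply: ltW; apply: Nr; exact: leq_maxr.
exists (mk_source cz); split; first by apply: a0V; exact: (Bz 0%N).
by move=> k _; exact/BU/Bz.
Qed.

End source_baire.

(** * Points in general position *)

Section general_position.
Context {R : realType}.

(** A line [W + t V] with [V] invertible meets the singular matrices for
    finitely many [t] only: they are opposite to eigenvalues of [W V^-1]. *)
Lemma singular_line_root (d : nat) (W V : 'M[R]_d) (t : R) :
  V \in unitmx -> \det (W + t *: V) = 0 ->
  root (char_poly (W *m invmx V)) (- t).
Proof.
move=> Vu /eqP/det0P[v v0 vWV]; rewrite -eigenvalue_root_char.
apply/eigenvalueP; exists v => //.
rewrite mulmxA; apply: (can_inj (mulmxK Vu)); rewrite mulmxKV//.
apply/eqP; rewrite -subr_eq0 -scalemxAl -scaleNr opprK.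
by rewrite scalemxAr -mulmxDr vWV.
Qed.

Lemma small_nonroot (p : {poly R}) (e : R) : p != 0 -> 0 < e ->
  exists t : R, [/\ 0 < t, t <= e & ~~ root p (- t)].
Proof.
move=> p0 e0; pose s := [seq - (e / k.+1%:R) | k <- iota 0 (size p)].
have us : uniq s.
  rewrite map_inj_uniq ?iota_uniq// => j k /oppr_inj/(mulfI (lt0r_neq0 e0)).
  by move=> /invr_inj/eqP; rewrite eqr_nat => /eqP[].
have /allPn[_ /mapP[k _ ->] nr] : ~~ all (root p) s.
  apply/negP => rs; have := max_poly_roots p0 rs us.
  by rewrite size_map size_iota ltnn.
exists (e / k.+1%:R); split => //; first by rewrite divr_gt0.
by rewrite ler_pdivrMr// ler_peMr ?ler1n// ltW.
Qed.

Lemma det_vandermonde_rows (d : nat) (a : 'I_d -> R) : injective a ->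
  (\matrix_(i < d, l < d) a i ^+ l) \in unitmx.
Proof.
move=> ai; rewrite -unitmx_tr.
have -> : (\matrix_(i < d, l < d) a i ^+ l)^T = Vandermonde d (\row_i a i).
  by apply/matrixP => i j; rewrite !mxE.
rewrite unitmxE det_Vandermonde unitfE; apply/prodf_neq0 => i _.
apply/prodf_neq0 => j ij; rewrite !mxE subr_eq0.
by apply: contraTneq ij => /ai ->; rewrite ltnn.
Qed.

(** Any [d] points of a moment curve are linearly independent, so the points
    are moved in the direction of such a curve, avoiding the finitely many
    parameters for which a relevant determinant vanishes. The extra indices
    ['I_d] stand for the target itself, so that subsets of fewer than [d]
    points can be completed to exactly [d]. *)
Lemma general_position (d : nat) (J B : finType) (w : J -> 'I_d -> R)
    (c : B -> 'I_d -> R) (e : R) : 0 < e ->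
  exists p : J -> 'I_d -> R, (forall j i, `|p j i - w j i| <= e) /\
    forall (phi : J -> R) (b : B), \sum_j phi j = 1 ->
      (#|finset (fun j => (phi j != 0)%R)| <= d)%N ->
      exists i, \sum_j phi j * p j i != c b i.
Proof.
move=> e0; pose E := (J + 'I_d)%type.
pose a (x : E) : R := (enum_rank x)%:R.
have a_inj : injective a.
  by move=> x y /eqP; rewrite eqr_nat => /eqP/val_inj/enum_rank_inj.
pose V (s : {ffun 'I_d -> E}) : 'M[R]_d := \matrix_(i, l) a (s i) ^+ l.
pose W (b : B) (s : {ffun 'I_d -> E}) : 'M[R]_d :=
  \matrix_(i, l) if s i is inl j then w j l - c b l else 0.
pose q := \prod_(b : B) \prod_(s : {ffun 'I_d -> E})
  char_poly (W b s *m invmx (V s)).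
have q0 : q != 0.
  apply/prodf_neq0 => b _; apply/prodf_neq0 => s _.
  exact/monic_neq0/char_poly_monic.
pose M : R := 1 + \sum_(x : E) \sum_(l < d) a x ^+ l.
have a0 x l : 0 <= a x ^+ l by rewrite exprn_ge0.
have M0 : 0 < M by rewrite ltr_pwDl// sumr_ge0// => x _; exact: sumr_ge0.
have aM x (l : 'I_d) : a x ^+ l <= M.
  rewrite /M (bigD1 x)//= (bigD1 l)//= addrCA -addrA lerDl.
  by rewrite !addr_ge0 ?ler01 ?sumr_ge0// => y _; rewrite sumr_ge0.
have [t [t0 te nrt]] := small_nonroot q0 (divr_gt0 e0 M0).
have det_neq0 b (s : {ffun 'I_d -> E}) : injective s ->
  \det (W b s + t *: V s) != 0.
  move=> si; apply: contraNneq nrt => /singular_line_root rt.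
  rewrite /q (bigD1 b)//= rootM (bigD1 s)//= rootM rt ?orbT//.
  by apply: det_vandermonde_rows; exact: inj_comp a_inj si.
exists (fun j i => w j i + t * a (inl j) ^+ i); split.
  move=> j i; rewrite addrC addKr normrM !ger0_norm ?(ltW t0)//.
  apply: le_trans (_ : e / M * M <= e); last by rewrite divfK// gt_eqF.
  by rewrite ler_pM// ltW.
move=> phi b phi1 phid; apply: contrapT => nphi.
have pc i : \sum_j phi j * (w j i + t * a (inl j) ^+ i) = c b i.
  by apply: contrapT => /eqP np; apply: nphi; exists i.
pose phi' (x : E) : R := if x is inl j then phi j else 0.
pose D := finset (fun x => phi' x != 0).
pose u := enum D ++ enum (~: D).
have uu : uniq u.
  rewrite cat_uniq !enum_uniq andbT /=; apply/hasPn => x.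
  by rewrite !mem_enum inE.
have Dd : (#|D| <= d)%N.
  apply: leq_trans phid; rewrite -(card_imset _ (@inl_inj J 'I_d)).
  apply/subset_leq_card/fintype.subsetP => -[j|i]; rewrite inE /= ?eqxx// => pj.
  by apply: imset_f; rewrite inE.
have su : (d <= size u)%N.
  by rewrite size_cat -!cardE cardsC card_sum card_ord leq_addl.
pose s : {ffun 'I_d -> E} := [ffun i : 'I_d => nth (inr i) u i].
have si : injective s.
  move=> i j; rewrite !ffunE => /eqP.
  rewrite (set_nth_default (inr i))// ?(leq_trans _ su)//.
  rewrite [X in _ == X](set_nth_default (inr i))// ?(leq_trans _ su)//.
  by rewrite nth_uniq ?(leq_trans _ su)// => /eqP/val_inj.
have Ds x : phi' x != 0 -> x \in s @: 'I_d.
  move=> px; have xD : x \in enum D by rewrite mem_enum inE.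
  have xd : (index x u < d)%N.
    by rewrite index_cat xD; apply: leq_trans Dd; rewrite cardE index_mem.
  apply/imsetP; exists (Ordinal xd); rewrite ?inE// ffunE /= nth_index//.
  by rewrite mem_cat xD.
have sumE (F : E -> R) : \sum_(i < d) phi' (s i) * F (s i) =
    \sum_j phi j * F (inl j).
  transitivity (\sum_(x in s @: 'I_d) phi' x * F x).
    rewrite big_imset /=; last by move=> i j _ _; exact: si.
    by apply: eq_bigl.
  transitivity (\sum_x phi' x * F x).
    rewrite [RHS](bigID (mem (s @: 'I_d)))/= [X in _ + X]big1 ?addr0// => x xs.
    have [->|px] := eqVneq (phi' x) 0; first by rewrite mul0r.
    by rewrite Ds in xs.
  rewrite big_sumType /= [X in _ + X]big1 ?addr0// => i _.
  by rewrite mul0r.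
have : (\row_i phi' (s i)) *m (W b s + t *: V s) = 0.
  apply/rowP => l; rewrite !mxE.
  under eq_bigr do rewrite !mxE.
  rewrite (sumE (fun x =>
    (if x is inl j then w j l - c b l else 0) + t * a x ^+ l)).
  have -> : \sum_j phi j * (w j l - c b l + t * a (inl j) ^+ l) =
      \sum_j phi j * (w j l + t * a (inl j) ^+ l) - (\sum_j phi j) * c b l.
    by rewrite mulr_suml -sumrB; apply: eq_bigr => j _; ring.
  by rewrite pc phi1 mul1r subrr.
have := det_neq0 b s si; rewrite -unitfE -unitmxE =>
  /mulmxK mK /(congr1 (mulmx^~ (invmx (W b s + t *: V s)))).
rewrite mK mul0mx => /rowP x0.
have : \sum_j phi j = 0.
  apply: big1 => j _; apply/eqP; apply: contrapT => /negP pj.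
  have /imsetP[i _ ji] := Ds (inl j) pj.
  by have := x0 i; rewrite !mxE -ji /= => /eqP; rewrite (negbTE pj).
by rewrite phi1 => /eqP; rewrite oner_eq0.
Qed.

End general_position.

(** * Perturbation over one fibre *)

Section perturbation.
Context {R : realType} {X : topologicalType} {n : nat}.
Implicit Types (g : X -> cube R n.+1) (h : 'I_n.+1 -> X -> R).

(** Nerve of a fine cover of multiplicity [n+1]: on [L] the perturbed map is
    the barycentric map of a partition of unity subordinate to that cover,
    whose values lie on simplices with at most [n+1] vertices; vertices in
    general position keep these off the finitely many points [c b]. The
    complement of [L] is one more member of the cover, where the map is left
    unchanged, so the perturbation is defined on the whole space and supported
    in [N]. *)
Lemma perturb_off_points g (L N : set X) (B : finType) (c : B -> 'I_n.+1 -> R)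
    (delta : R) : normal_space X -> continuous g -> closed L -> open N ->
  L `<=` N -> 0 < delta ->
  (forall (J : finType) (U : J -> set X), (forall j, open (U j)) ->
    (forall x, L x -> exists j, U j x) ->
    exists V : J -> set X, [/\ forall j, open (V j), forall j, V j `<=` U j,
      forall x, L x -> exists j, V j x & order_le L V n.+1]) ->
  exists h, [/\ forall i, continuous (h i), forall i x, `|h i x| <= delta,
    forall i x, ~ N x -> h i x = 0 &
    forall x b, L x -> exists i, coord (g x) i + h i x != c b i].
Proof.
move=> nX cg cL oN LN d0 dL; have d2 : 0 < delta / 2 by rewrite divr_gt0.
have [J [D [oD dD cD]]] := @cube_finite_cover R n.+1 _ d2.
have [|x Lx|V [oV VU cV mV]] := dL J (fun j => N `&` g @^-1` D j).
- by move=> j; apply: openI => //; exact: (@open_comp _ _ g _ (in1W cg) (oD j)).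
- by have [j Dx] := cD (g x); exists j; split => //; exact: LN.
pose W (o : J + unit) : set X := if o is inl j then V j else ~` L.
have [||phi [cphi phi0 phi1 phiW]] := @normal_partition_of_unity _ R _ W nX.
- by move=> [j|u] //=; exact: closed_openC.
- move=> x; have [/cV[j Vx]|nL] := pselect (L x); first by exists (inl j).
  by exists (inr tt).
have /choice[w wP] (j : J) : exists w : 'I_n.+1 -> R,
    forall x i, V j x -> `|w i - coord (g x) i| <= delta / 2.
  have [[x0 Vx0]|nV] := pselect (V j !=set0); last first.
    by exists (fun=> 0) => x i Vx; exfalso; apply: nV; exists x.
  exists (coord (g x0)) => x i Vx; apply: le_trans (coord_dist_le _ _ _) _.
  by apply: ltW; apply: (dD j); [have [] := VU _ _ Vx0|have [] := VU _ _ Vx].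
have [p [pw pc]] := general_position w c d2.
have pg j x i : V j x -> `|p j i - coord (g x) i| <= delta.
  move=> Vx; have := ler_distD (w j i) (p j i) (coord (g x) i).
  by have := wP j x i Vx; have := pw j i; lra.
pose h i x := \sum_j phi (inl j) x * (p j i - coord (g x) i).
have sum_le1 x : \sum_j phi (inl j) x <= 1.
  by rewrite -(phi1 x) big_sumType /= lerDl sumr_ge0.
exists h; split.
- move=> i; apply: continuous_sumr => j x; apply: cvgM; first exact: cphi.
  apply: cvgB; first exact: cvg_cst.
  exact: (continuous_comp_fun cg (@coord_continuous _ _ i)).
- move=> i x; apply: le_trans (ler_norm_sum _ _ _) _.
  apply: (@le_trans _ _ (\sum_j phi (inl j) x * delta)); last first.
    by rewrite -mulr_suml ler_piMl// ltW.
  apply: ler_sum => j _; rewrite normrM ger0_norm//.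
  have [->|pj] := eqVneq (phi (inl j) x) 0; first by rewrite !mul0r.
  by apply: ler_wpM2l => //; apply: pg; exact: (phiW _ _ pj).
- move=> i x Nx; apply: big1 => j _; have [->|pj] := eqVneq (phi (inl j) x) 0.
    by rewrite mul0r.
  by have [] := VU _ _ (phiW _ _ pj : V j x).
- move=> x b Lx.
  have phiN : phi (inr tt) x = 0.
    by apply/eqP; apply: contrapT => /negP /phiW /=.
  have phi1x : \sum_j phi (inl j) x = 1.
    by rewrite -(phi1 x) big_sumType /= [X in _ + X]big1 ?addr0// => -[].
  have [|i ci] := pc (fun j => phi (inl j) x) b phi1x.
    by apply: (mV x Lx) => j; rewrite inE => /phiW.
  exists i; apply: contraNneq ci => <-; apply/eqP.
  rewrite /h; under [in RHS]eq_bigr do rewrite mulrBr.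
  by rewrite sumrB -mulr_suml phi1x mul1r addrC subrK.
Qed.

End perturbation.

(** * Openness and local perturbation *)

Section fibrewise_thin.
Context {R : realType} {X Y : topologicalType} {n : nat}.
Variables (f : X -> Y) (F : set X).
Hypotheses (cf : continuous f) (pY : paracompact Y) (cF : closed F).
Hypotheses (pfF : perfect_map (sigLR [fun f in F])) (cfF : closed (f @` F)).

Local Notation fibre y := (F `&` f @^-1` [set y]).

Definition fibrewise_small (e : R) : set (source_lim X (cube R n.+1)) :=
  [set g | forall y, small_cover e n.+1 (g @` fibre y)].

(** A cover of [g @` fibre y] also covers [h @` fibre y'] when [y'] is close to
    [y] and [h] is close to [g]. The closeness needed can be chosen
    continuously on [Y], which gives a neighbourhood of [g]. *)
Lemma fibrewise_small_open (e : R) : open (fibrewise_small e).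
Proof.
rewrite source_openE => g gs;
  have cg : continuous g by exact: source_continuous.
pose good y (d : R) := forall h : source_lim X (cube R n.+1),
  (forall x, f x = y -> mdist (g x) (h x) <= d) ->
  small_cover e n.+1 (h @` fibre y).
have [||a [ca a0 ga]] := @paracompact_continuous_radius R Y good pY.
- move=> y d d' _ dd' gd h gh; apply: gd => x fx.
  exact: le_trans (gh x fx) dd'.
- move=> y; have [J [V [oV dV cV mV]]] := gs y.
  have cK : compact (g @` fibre y).
    apply: continuous_compact; last exact: perfect_restriction_fibre_compact.
    exact: continuous_subspaceT.
  have [r r0 rV] := compact_lebesgue_number cK oV cV.
  have r2 : 0 < r / 2 by rewrite divr_gt0.
  pose N := g @^-1` (\bigcup_(z in g @` fibre y) (ball z (r / 2))°).
  have oN : open N.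
    apply: (@open_comp _ _ g _ (in1W cg)); apply: bigcup_open => z _.
    exact: open_interior.
  have [|W [oW Wy WN]] := perfect_restriction_tube pfF cfF oN (y := y).
    by move=> x Kx; exists (g x); [exists x|exact: nbhsx_ballx].
  exists (r / 4); first by rewrite divr_gt0.
  apply: (filterS _ (open_nbhs_nbhs (conj oW Wy))) => y' Wy' h gh.
  exists J, V; split => // _ [x [Fx fx] <-].
  have [|z zK /interior_subset zgx] := WN x; first by split => //=; rewrite fx.
  have [j zj] := rV z zK; exists j; apply: zj.
  move: zgx; rewrite !ballEmdist /= => zgx.
  by have := metric_triangle z (g x) (h x); have := gh x fx; lra.
exists (a \o f); split => //.
- exact: continuous_comp_fun.
- by move=> x; exact: a0.
- by move=> h gh y; apply: ga => x <-; exact: gh.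
Qed.

Section local_step.
Variables (nX : normal_space X) (y : Y) (g : X -> cube R n.+1) (a : X -> R).
Variables (B : finType) (c : B -> 'I_n.+1 -> R) (r : R).
Hypotheses (dy : covdim_lt (f @^-1` [set y]) n.+1) (cg : continuous g).
Hypotheses (ca : continuous a) (a_gt0 : forall x, 0 < a x) (r_gt0 : 0 < r).

Let near_targets (s : R) : set X :=
  [set x | exists b, forall i, `|coord (g x) i - c b i| < s].

(** In the proof, [N] is the region where [g] may be moved, and [L] is the part
    of the fibre at risk: elsewhere on the fibre, values are farther than half
    of [r] from the targets and a displacement of at most a quarter of [r] does
    not reach them. Missing the targets is an open condition, so it persists
    over a neighbourhood of [y]. *)
Lemma local_perturbation : exists W (h : 'I_n.+1 -> X -> R),
  [/\ open W, W y, forall i, continuous (h i) &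
  [/\ forall i x, `|h i x| <= a x, forall i x, `|h i x| <= r / 4,
      forall i x, ~ near_targets r x -> h i x = 0 &
      forall x b, F x -> W (f x) -> exists i, coord (g x) i + h i x != c b i]].
Proof.
have cgi i : continuous (fun x => coord (g x) i).
  exact: (continuous_comp_fun cg (@coord_continuous _ _ i)).
have cK : compact (fibre y) by exact: perfect_restriction_fibre_compact.
have [d0 d0_gt0 d0a] := compact_positive_lower_bound cK ca a_gt0.
pose delta := Num.min d0 (r / 4).
have delta_gt0 : 0 < delta by rewrite lt_min d0_gt0 divr_gt0.
have onear s : open (near_targets s).
  rewrite (_ : near_targets s = \bigcup_b
      [set x | forall i, [set x | `|coord (g x) i - c b i| < s] x]).
    apply: bigcup_open => b _; apply: open_forall => i.
    exact: (@open_comp _ _ _ _ (in1W (cgi i)) (@open_dist_lt _ (c b i) s)).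
  by apply/seteqP; split => x [b]; [move=> ?|move=> _ ?]; exists b.
pose N := near_targets r `&` [set x | delta < a x].
have oN : open N.
  apply: openI; first exact: onear.
  exact: (@open_comp _ _ a _ (in1W ca) (@open_gt _ delta)).
pose L := (F `&` f @^-1` [set y]) `&`
  \bigcup_(b in [set: B]) [set x | forall i, `|coord (g x) i - c b i| <= r / 2].
have hY : hausdorff_space Y := pY.1.
have cy : closed (f @^-1` [set y]).
  apply: preimage_closed; first by move=> x _; exact: cf.
  by apply: accessible_closed_set1; exact: hausdorff_accessible.
have cL : closed L.
  apply: closedI; first exact: closedI.
  apply: closed_bigcup => [|b _]; first exact: finite_finset.
  rewrite (_ : [set x | _] =
    \bigcap_i [set x | `|coord (g x) i - c b i| <= r / 2]); last first.
    by apply/seteqP; split => x H i; [move=> _|]; exact: H.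
  apply: closed_bigI => i _.
  rewrite (_ : [set x | _] =
    (fun x => coord (g x) i) @^-1` [set t | `|t - c b i| <= r / 2])//.
  apply: preimage_closed; first by move=> x _; exact: cgi.
  rewrite (_ : [set t | _] = closed_ball (c b i) (r / 2));
    first exact: closed_ball_closed.
  by rewrite closed_ballE ?divr_gt0//; apply/seteqP; split => t;
    rewrite /closed_ball_ /= distrC.
have LN : L `<=` N.
  move=> x [Kx [b _ xb]]; split.
    by exists b => i; apply: le_lt_trans (xb i) _;
      rewrite ltr_pdivrMr// ltr_pMr// ltr1n.
  by apply: le_lt_trans (d0a x Kx); rewrite ge_min lexx.
have [J U oU cU|h [ch hd hN hL]] :=
  perturb_off_points c nX cg cL oN LN delta_gt0.
  by apply: (covdim_lt_subset dy) => // x [[_ ?]].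
pose good := [set x | forall b, exists i, coord (g x) i + h i x != c b i].
have ogood : open good.
  apply: open_forall => b.
  have -> : (fun x => exists i, coord (g x) i + h i x != c b i) =
      \bigcup_i [set x | coord (g x) i + h i x != c b i].
    by apply/seteqP; split => x [i]; [move=> ?|move=> _ ?]; exists i.
  apply: bigcup_open => i _.
  rewrite (_ : [set x | _] =
    (fun x => coord (g x) i + h i x) @^-1` [set t | t != c b i])//.
  apply: (@open_comp _ _ _ _ (in1W _)); last exact: open_neq.
  by move=> x; apply: cvgD; [exact: cgi|exact: ch].
have [x Kx b|W [oW Wy Wgood]] :=
  perfect_restriction_tube pfF cfF ogood (y := y).
  have [Lx|nLx] := pselect (L x); first exact: hL.
  have [i xi] : exists i, r / 2 < `|coord (g x) i - c b i|.
    apply: contrapT => nx; apply: nLx; split => //; exists b => // i.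
    by rewrite leNgt; apply/negP => xi; apply: nx; exists i.
  exists i; apply/eqP => gh; move: xi.
  rewrite -gh opprD addrA subrr sub0r normrN.
  have := hd i x; rewrite /delta le_min => /andP[_ h1 h2].
  by have := r_gt0; lra.
exists W, h; split => //; split.
- move=> i x; have [Nx|nNx] := pselect (N x); last by rewrite hN// normr0 ltW.
  by apply: le_trans (hd i x) _; apply: ltW; case: Nx.
- by move=> i x; apply: le_trans (hd i x) _; rewrite ge_min lexx orbT.
- by move=> i x nx; apply: hN => -[].
- by move=> x b Fx Wx; exact: (Wgood x (conj Fx Wx)).
Qed.

End local_step.

End fibrewise_thin.

(** * Density *)

Section levels.
Context {R : realType}.

(** The grid of level [k], rescaled to mesh 1, is translated by [- grid_shift
    k] in all the coordinates. *)
Definition grid_shift (k : nat) : R := 2^-1 ^+ k / 8.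

Lemma grid_shift_gt0 k : 0 < grid_shift k.
Proof. by rewrite divr_gt0// exprn_gt0. Qed.

Lemma grid_shift_le k : grid_shift k <= 1 / 8.
Proof. by rewrite ler_pM2r// exprn_ile1// invf_le1// ler1n. Qed.

Lemma grid_shift_half k l : (k < l)%N -> grid_shift l <= grid_shift k / 2.
Proof.
move=> kl; rewrite /grid_shift mulrAC ler_pM2r// -exprSr.
by apply: ler_wiXn2l => //; rewrite invf_le1// ler1n.
Qed.

(** The shifts decrease by a factor of at least 2 and stay below 1/8, so that
    points of two levels are at distance at least half the larger shift. The
    constant 5/4 accounts for a radius and a displacement by a quarter of it.
    *)
Lemma grid_shift_separated (k l b c : nat) (u : R) : k != l ->
  `|u - (b%:R + 1 / 2 - grid_shift k)| < 5 / 4 * (grid_shift k / 8) ->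
  `|u - (c%:R + 1 / 2 - grid_shift l)| < 5 / 4 * (grid_shift l / 8) -> False.
Proof.
have aux (k' l' b' c' : nat) : (k' < l')%N ->
    `|u - (b'%:R + 1 / 2 - grid_shift k')| < 5 / 4 * (grid_shift k' / 8) ->
    `|u - (c'%:R + 1 / 2 - grid_shift l')| < 5 / 4 * (grid_shift l' / 8) ->
      False.
  move=> /grid_shift_half kl; have := grid_shift_gt0 k';
    have := grid_shift_gt0 l'.
  have := grid_shift_le k';
    rewrite !ltr_norml => s1 s2 s3 /andP[h1 h2] /andP[h3 h4].
  have [bc|bc|bc] := ltngtP b' c'.
  - have : b'%:R + 1 <= c'%:R :> R by rewrite natr1 ler_nat.
    by move=> ?; lra.
  - have : c'%:R + 1 <= b'%:R :> R by rewrite natr1 ler_nat.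
    by move=> ?; lra.
  - by subst c'; lra.
by rewrite neq_ltn => /orP[/aux kl|/aux lk] h1 h2;
  [exact: kl h1 h2|exact: lk h2 h1].
Qed.

End levels.

Section density.
Context {R : realType} {X Y : topologicalType} {n : nat}.
Variables (f : X -> Y) (F : set X).
Hypotheses (cf : continuous f) (pY : paracompact Y) (cF : closed F).
Hypotheses (pfF : perfect_map (sigLR [fun f in F])) (cfF : closed (f @` F)).
Hypotheses (nX : normal_space X) (CY : C_space Y).
Hypothesis (dY : forall y, covdim_lt (f @^-1` [set y]) n.+1).

(** At level [k] the map is moved only where its values are near the [k]-th set
    of grid centres, and they remain near it. Distinct levels therefore act on
    disjoint parts of [X], and over the points with [phi k = 1] the images of
    fibres miss the [k]-th set of centres. *)
Lemma fibrewise_small_dense (e : R) : 0 < e ->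
  dense (fibrewise_small (n := n) f F e).
Proof.
move=> e0 V [g Vg] oV; rewrite source_openE in oV.
have [a0 [ca0 a00 a0V]] := oV _ Vg.
have cg : continuous g by exact: source_continuous.
have cgi i : continuous (fun x => coord (g x) i).
  exact: (continuous_comp_fun cg (@coord_continuous _ _ i)).
pose a x := a0 x / n.+1%:R.
have ca : continuous a by move=> x; apply: cvgM; [exact: ca0|exact: cvg_cst].
have a_gt0 x : 0 < a x by rewrite divr_gt0.
have [M M0 Me] : exists2 M : nat, (0 < M)%N & n.+1%:R / M%:R < e.
  have ne : 0 <= n.+1%:R / e by rewrite divr_ge0// ltW.
  exists (Num.bound (n.+1%:R / e)).+1 => //.
  rewrite ltr_pdivrMr// mulrC -ltr_pdivrMr//.
  by apply: lt_trans (archi_boundP ne) _; rewrite ltr_nat.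
have M0' : 0 < M%:R :> R by rewrite ltr0n.
(* The centres of the cubes of a grid of mesh [1 / M], translated. *)
pose B := {ffun 'I_n.+1 -> 'I_M}.
pose c k (b : B) i : R := ((b i)%:R + 1 / 2 - grid_shift k) / M%:R.
pose r k : R := grid_shift k / 8 / M%:R.
have r_gt0 k : 0 < r k by rewrite !divr_gt0// grid_shift_gt0.
have scaled (t v w : R) : `|t - v / M%:R| < w / M%:R -> `|M%:R * t - v| < w.
  rewrite ltr_pdivlMr// -{2}(ger0_norm (ltW M0')) -normrM mulrBl divfK
    ?gt_eqF//.
  by rewrite mulrC.
pose near k x := exists b : B, forall i, `|coord (g x) i - c k b i| < r k.
pose Q k (W : set Y) (h : 'I_n.+1 -> X -> R) :=
  [/\ forall i, continuous (h i), forall i x, `|h i x| <= a x,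
      forall i x, `|h i x| <= r k / 4, forall i x, ~ near k x -> h i x = 0 &
      forall x b, F x -> W (f x) -> exists i, coord (g x) i + h i x != c k b i].
(* The admissible open sets of level [k]: above them [g] can be pushed off the
   [k]-th set of grid centres. The levels do not interact, so that all
   covers are available before property C is applied. *)
pose omega k : set (set Y) := [set W | open W /\ exists h, Q k W h].
have omega_cover k : open_cover (omega k).
  split=> [W []//|]; rewrite -subTset => y _.
  have [W [h [oW Wy ch [ha hr hnear hmiss]]]] :=
    @local_perturbation R X Y n f F cf pY cF pfF cfF nX y g a B (c k) (r k)
      (@dY y) cg ca a_gt0 (r_gt0 k).
  by exists W => //; split => //; exists h; split.
have [gamma [ogamma tgamma rgamma cgamma]] := CY omega_cover.
pose O k := \bigcup_(W in gamma k) W.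
have oO k : open (O k) by apply: bigcup_open => W /ogamma.
have [phi [cphi phi01 phiO phi1]] :=
  @paracompact_countable_bumps R Y O pY oO cgamma.
have /choice[pert pertP] (p : nat * set Y) : exists h,
    gamma p.1 p.2 -> Q p.1 p.2 h.
  case: p => k W; have [gW|ngW] := pselect (gamma k W);
    last by exists (fun _ _ => 0).
  have [W' [_ [h [ch ha hr hn hm]]] WW'] := rgamma k W gW.
  by exists h => _; split => // x b Fx /WW'; exact: hm.
have /choice[cell cellP] (p : nat * Y) : exists W,
    O p.1 p.2 -> gamma p.1 W /\ W p.2.
  case: p => k y; have [[W gW Wy]|nO] := pselect (O k y); last by exists set0.
  by exists W.
have cell_eq k y W : gamma k W -> W y -> cell (k, y) = W.
  move=> gW Wy; have [gC Cy] := cellP (k, y) (ex_intro2 _ _ W gW Wy).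
  by apply: (tgamma k) => //; exists y.
pose t k i x : R := if `[< O k (f x) >] then pert (k, cell (k, f x)) i x else 0.
have tQ k x : O k (f x) -> exists W h,
    [/\ gamma k W, W (f x), Q k W h & forall i, t k i x = h i x].
  move=> Ox; have [gW Wx] := cellP (k, f x) Ox.
  exists (cell (k, f x)), (pert (k, cell (k, f x))); split => //.
    exact: pertP.
  by move=> i; rewrite /t; case: asboolP.
have tout k i x : ~ O k (f x) -> t k i x = 0 by rewrite /t; case: asboolP.
have ta k i x : `|t k i x| <= a x.
  have [/tQ[W [h [_ _ [_ ha _ _ _] ->]]]//|/tout->] := pselect (O k (f x)).
  by rewrite normr0 ltW.
have tr k i x : `|t k i x| <= r k / 4.
  have [/tQ[W [h [_ _ [_ _ hr _ _] ->]]]//|/tout->] := pselect (O k (f x)).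
  by rewrite normr0 divr_ge0// ltW.
have tnear k i x : ~ near k x -> t k i x = 0.
  move=> nx; have [/tQ[W [h [_ _ [_ _ _ hn _] ->]]]|/tout//] :=
    pselect (O k (f x)).
  exact: hn.
pose T k i x := phi k (f x) * t k i x.
have Tt k i x : `|T k i x| <= `|t k i x|.
  have /andP[p0 p1] := phi01 k (f x).
  by rewrite normrM ger0_norm// ler_piMl.
have Tnear k i x : ~ near k x -> T k i x = 0.
  by move=> /tnear t0; rewrite /T t0 mulr0.
have cT k i : continuous (T k i).
  apply: (@cutoff_continuous _ _ _ _ (r k / 4)) => //.
    exact: (continuous_comp_fun cf (cphi k)).
  move=> x /phiO [W gW Wx]; have Qh := pertP (k, W) gW.
  exists (pert (k, W) i); first by have [] := Qh.
  have : \forall x' \near x, (f @^-1` W) x'.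
    apply: open_nbhs_nbhs; split => //.
    exact: (@open_comp _ _ f _ (in1W cf) (ogamma _ _ gW)).
  apply: filterS => x' Wx'; rewrite /t (cell_eq k _ W)//.
  by case: asboolP => // -[]; exists W.
have near_uniq k l x : near k x -> near l x -> k = l.
  move=> [b xb] [b' xb']; apply/eqP; apply: contrapT => /negP kl.
  have := xb ord0; have := xb' ord0; rewrite /c /r => /scaled h1 /scaled h2.
  apply: (grid_shift_separated kl (lt_trans h2 _) (lt_trans h1 _));
    rewrite ltr_pMl ?divr_gt0 ?grid_shift_gt0//; lra.
(* At most one level is active at [x], and [s x] is its contribution. *)
have /choice[s sP] x : exists v : 'I_n.+1 -> R,
    (forall k, near k x -> forall i, v i = T k i x) /\
    ((forall k, ~ near k x) -> forall i, v i = 0).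
  have [[k kx]|nk] := pselect (exists k, near k x); last first.
    by exists (fun=> 0); split => // k kx; exfalso; apply: nk; exists k.
  exists (fun i => T k i x); split; last by move=> /(_ k).
  by move=> l lx i; rewrite (near_uniq _ _ _ kx lx).
have scase x : (exists2 k, near k x & forall i, s x i = T k i x) \/
    ((forall k, ~ near k x) /\ forall i, s x i = 0).
  have [sk s0] := sP x; have [[k kx]|nk] := pselect (exists k, near k x).
    by left; exists k => //; exact: sk.
  have nk' k : ~ near k x by move=> kx; apply: nk; exists k.
  by right; split => //; exact: s0.
have cs i : continuous (fun x => s x i).
  apply: uniform_approx_continuous => d d0.
  have [N Nd] : exists N, forall k, (N <= k)%N -> r k / 4 < d.
    have /cvgrPdist_lt/(_ d d0)[N _ Nd] :
      (fun k => 2^-1 ^+ k : R) @ \oo --> (0 : R).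
      by apply: cvg_expr; rewrite ger0_norm ?invf_lt1 ?ltr1n.
    exists N => k /Nd /=; rewrite sub0r normrN ger0_norm ?exprn_ge0//.
    apply: le_lt_trans; rewrite /r /grid_shift -!mulrA ler_piMr ?exprn_ge0//.
    have M1 : M%:R^-1 <= 1 :> R by rewrite invf_le1// ler1n.
    have M2 : 0 < M%:R^-1 :> R by rewrite invr_gt0.
    by move: M1 M2; set w := _^-1 => M1 M2; lra.
  exists (fun x => \sum_(k < N) T k i x); split.
    by apply: continuous_sumr => k; exact: cT.
  move=> x; rewrite /ball /=; have [[k kx ->]|[nk ->]] := scase x; last first.
    by rewrite big1 ?subrr ?normr0// => k _; exact: Tnear.
  have Tl (l : nat) : l != k -> T l i x = 0.
    move=> lk; apply: Tnear => lx; move: lk.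
    by rewrite (near_uniq _ _ _ lx kx) eqxx.
  have [kN|Nk] := ltnP k N.
    rewrite (bigD1 (Ordinal kN))//= big1 ?addr0 ?subrr ?normr0// => l lk.
    by apply: Tl; apply: contraNneq lk => lk; apply/eqP/val_inj.
  rewrite big1 ?sub0r ?normrN => [|l _]; last first.
    by apply: Tl; rewrite neq_ltn (leq_trans (ltn_ord l) Nk).
  exact: le_lt_trans (le_trans (Tt k i x) (tr k i x)) (Nd k Nk).
have near_bound k x b i : (forall i, `|coord (g x) i - c k b i| < r k) ->
    `|M%:R * (coord (g x) i + T k i x) - ((b i)%:R + 1 / 2 - grid_shift k)| <
      5 / 4 * (grid_shift k / 8).
  move=> xb; apply: scaled; rewrite addrAC.
  apply: le_lt_trans (ler_normD _ _) _.
  rewrite (_ : 5 / 4 * _ / _ = r k + r k / 4); last by rewrite /r; field;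
    rewrite gt_eqF.
  by apply: ltr_leD; [exact: xb|exact: le_trans (Tt _ _ _) (tr _ _ _)].
have gs01 x i : 0 <= coord (g x) i + s x i <= 1.
  have [[k [b xb] ->]|[_ ->]] := scase x; last by rewrite addr0 coord01.
  have := near_bound k x b i xb; rewrite ltr_norml => /andP[].
  have := @grid_shift_gt0 R k; have := @grid_shift_le R k.
  have : (b i)%:R + 1 <= M%:R :> R by rewrite natr1 ler_nat ltn_ord.
  have : 0 <= (b i)%:R :> R by [].
  move: (coord (g x) i + T k i x) => v b0 bM s1 s0 h1 h2.
  have v0 : 0 < M%:R * v by lra.
  have v1 : M%:R * v < M%:R * 1 by lra.
  rewrite ltr_pM2l// in v1; rewrite pmulr_rgt0// in v0.
  by rewrite !ltW.
have /choice[g' g'E] x := cube_of_coords (gs01 x).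
have cg' : continuous g'.
  apply: continuous_cube => i; under eq_fun do rewrite g'E.
  by move=> x; apply: cvgD; [exact: cgi|exact: cs].
exists (mk_source cg'); split.
  apply: a0V => x; rewrite (_ : a0 x = n.+1%:R * a x); last first.
    by rewrite mulrC divfK.
  apply: cube_dist_le => i; rewrite g'E opprD addrA subrr sub0r normrN.
  have [[k kx ->]|[_ ->]] := scase x; last by rewrite normr0 ltW.
  exact: le_trans (Tt k i x) (ta k i x).
move=> y; have [k phik] := phi1 y.
have yO : O k y by apply: phiO; rewrite phik oner_neq0.
apply: (grid_small_cover (s := grid_shift k) M0 _ _ _ Me).
- exact/ltW/grid_shift_gt0.
- apply: continuous_compact; last exact: perfect_restriction_fibre_compact.
  exact: continuous_subspaceT.
move=> _ [x [Fx fx] <-] /=; apply: contrapT => nhalf.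
have half i : exists b : nat,
  M%:R * coord (g' x) i + grid_shift k = b%:R + 1 / 2.
  apply: contrapT => nb; apply: nhalf; exists i => b; apply/eqP => Mb.
  by apply: nb; exists b.
have /choice[b bP] i : exists b : 'I_M,
    coord (g' x) i = (b%:R + 1 / 2 - grid_shift k) / M%:R.
  have [b bE] := half i; have bM : (b < M)%N.
    rewrite -(ltr_nat R); have /andP[_ g1] := coord01 (g' x) i.
    have : M%:R * coord (g' x) i <= M%:R * 1 by rewrite ler_pM2l.
    by have := @grid_shift_le R k; lra.
  exists (Ordinal bM) => /=; rewrite -bE addrK mulrAC divff ?mul1r// gt_eqF//.
pose b' : B := [ffun i => b i].
have g'c i : coord (g' x) i = c k b' i by rewrite bP /c ffunE.
have [nk|nnk] := pselect (near k x).
  have sT : forall i, s x i = T k i x by have [sk _] := sP x; exact: sk.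
  have [|W [h [gW Wx [_ _ _ _ hm] th]]] := tQ k x; first by rewrite fx.
  have [i /eqP] := hm x b' Fx Wx; apply.
  by rewrite -g'c g'E sT /T fx phik mul1r th.
have [[l lx sl]|[_ s0]] := scase x.
  have kl : k != l by apply/eqP => kl; apply: nnk; rewrite kl.
  case: lx => b'' xb''; have := near_bound l x b'' ord0 xb''.
  rewrite -sl -g'E; apply: (grid_shift_separated (b := b ord0) kl).
  rewrite bP mulrC divfK ?gt_eqF// subrr normr0.
  by have := @grid_shift_gt0 R k; lra.
apply: nnk; exists b' => i; rewrite -g'c g'E s0 addr0 subrr normr0.
exact: r_gt0.
Qed.

End density.

(** * The theorem *)

Theorem theorem1p1 (R : realType) (n : nat) (X Y : topologicalType)
    (f : X -> Y) (hX : paracompact X) (hY : paracompact Y) (hC : C_space Y)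
    (hf : sigma_perfect_map f) (hsurj : set_surj [set: X] [set: Y] f)
    (hdim : (dim_map R f <= n%:R%:E)%E) :
  let H :=
    [set g : source_lim X (cube R n.+1) | forall y : Y,
      (covdim R (g @` (f @^-1` [set y])) <= n%:R%:E)%E] in
  dense H /\ Gdelta H.
Proof.
move=> H; have [cf [F [cF FT pfF cfF]]] := hf.
have nX := paracompact_normal hX.
have dY y : covdim_lt (f @^-1` [set y]) n.+1.
  apply/(covdim_leP R); apply: le_trans hdim.
  by apply: ereal_sup_ubound; exists y.
(* The conditions, over all pieces [F i] and meshes [e m], in one sequence. *)
pose e (m : nat) : R := m.+1%:R^-1.
have e_gt0 m : 0 < e m by rewrite invr_gt0.
pose U (k : nat) := if unpickle k is Some (i, m)
  then fibrewise_small f (F i) (e m) else [set: source_lim X (cube R n.+1)].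
have oU k : open (U k).
  rewrite /U; case: unpickle => [[i m]|]; last exact: openT.
  by apply: fibrewise_small_open.
have dU k : dense (U k).
  rewrite /U; case: unpickle => [[i m]|]; last by move=> V V0 _; rewrite setIT.
  by apply: fibrewise_small_dense.
suff HE : H = \bigcap_k U k.
  by split; [rewrite HE; exact: source_baire|exists U].
apply/seteqP; split => g.
- move=> Hg k _; rewrite /U; case: unpickle => [[i m]|]// y.
  have /covdim_leP dA := Hg y.
  have [J [B [oB dB cB]]] := @cube_finite_cover R n.+1 _ (e_gt0 m).
  apply: small_coverS (covdim_lt_small_cover oB dB cB dA).
  by move=> _ [x [_ fx] <-]; exists x.
- move=> Ug y; apply/covdim_leP.
  apply: (@covdim_lt_bigcup_compact _ _ _ (fun i =>
    g @` (F i `&` f @^-1` [set y]))).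
  + move=> i; apply: continuous_compact;
      last exact: perfect_restriction_fibre_compact.
    by apply: continuous_subspaceT; exact: source_continuous.
  + apply/seteqP; split => [_ [x fx <-]|_ [i _ [x [_ fx] <-]]];
      last by exists x.
    have [i _ Fx] : (\bigcup_i F i) x by rewrite FT.
    by exists i => //; exists x.
  + move=> i d d0.
    have [m md] : exists m, e m < d.
      exists (Num.bound d^-1); rewrite /e invf_plt ?posrE//.
      apply: lt_trans (archi_boundP _) _; first by rewrite invr_ge0 ltW.
      by rewrite ltr_nat.
    have := Ug (pickle (i, m)) I;
      rewrite /U pickleK => /(_ y)[J [V [oV dV cV mV]]].
    by exists J, V; split => // j x z Vx Vz;
      exact: lt_trans (dV j x z Vx Vz) md.
Qed.
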